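(* Let $p$ be a prime, $d\ge 2$, and let $\Omega=B_\gamma(a)\times\Theta$ be a cylindric set in $\mathbb{Q}_p^d$, where $a\in\mathbb{Q}_p$, $\gamma\in\mathbb{Z}$ and $\Theta\subset\mathbb{Q}_p^{d-1}$ is a Borel set. Then $\Omega$ is a spectral set in $\mathbb{Q}_p^d$ if and only if $\Theta$ is a spectral set in $\mathbb{Q}_p^{d-1}$.
   Context: $\mathbb{Q}_p^d$ carries the Haar measure normalized so that $\mathbb{Z}_p^d$ has measure $1$, and the scalar product $x\cdot y=\sum_j x_jy_j$. For $a\in\mathbb{Q}_p$ and $\gamma\in\mathbb{Z}$, $B_\gamma(a)=\{x\in\mathbb{Q}_p:|x-a|_p\le p^\gamma\}$. A Borel set $\Omega\subset\mathbb{Q}_p^d$ ($d\ge2$) of positive and finite Haar measure is called cylindric if it has the form $\Omega=B_\gamma(a)\times\Theta$ with $B_\gamma(a)\subset\mathbb{Q}_p$ a ball and $\Theta$ a Borel set in $\mathbb{Q}_p^{d-1}$. For $x\in\mathbb{Q}_p$, $\{x\}$ denotes the $p$-adic fractional part, i.e. $\{x\}=\sum_{n=v}^{-1}a_np^n$ if $x=\sum_{n\ge v}a_np^n$ with $a_n\in\{0,\dots,p-1\}$ and $v<0$, and $\{x\}=0$ for $x\in\mathbb{Z}_p$. For $\lambda\in\mathbb{Q}_p^m$ let $\chi_\lambda(x)=e^{2\pi i\{\lambda\cdot x\}}$, $x\in\mathbb{Q}_p^m$; these are all the continuous characters of $\mathbb{Q}_p^m$. A Borel set $\Omega\subset\mathbb{Q}_p^m$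 of positive and finite Haar measure is a spectral set if there is a set $\Lambda\subset\mathbb{Q}_p^m$ (a spectrum of $\Omega$) such that $\{\chi_\lambda:\lambda\in\Lambda\}$ is an orthogonal basis of $L^2(\Omega)$. *)

(* Defs.v *)
From HB Require Import structures.
From mathcomp Require Import all_boot all_order all_algebra.
From mathcomp Require Import all_classical all_reals all_analysis.
From mathcomp.real_closed Require Import complex.

Set Implicit Arguments.
Unset Strict Implicit.
Unset Printing Implicit Defensive.

Import Order.TTheory GRing.Theory Num.Theory.
Import numFieldNormedType.Exports.

Local Open Scope classical_set_scope.
Local Open Scope ring_scope.

(* Z_p is the inverse limit of the rings Z/p^n: [x n] is the representative  *)
(* in {0, ..., p^n - 1} of the class of x modulo p^n (the bound x n < p^n    *)
(* follows from coherence).                                                  *)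
Definition padic_coherent (p : nat) (x : nat -> nat) : Prop :=
  forall n, (x n.+1 %% p ^ n)%N = x n.

Definition padic_int (p : nat) (hp : prime p) : Type :=
  {x : nat -> nat | `[< padic_coherent p x >]}.

HB.instance Definition _ p (hp : prime p) :=
  gen_eqMixin (padic_int hp).
HB.instance Definition _ p (hp : prime p) :=
  gen_choiceMixin (padic_int hp).

Section PadicInt.
Variables (p : nat) (hp : prime p).
Local Notation Zp := (padic_int hp).

Lemma padic_int_inj (x y : Zp) : sval x =1 sval y -> x = y.
Proof.
case: x y => [x hx] [y hy] /= /funext xy.
by case: y / xy hy => hy; congr exist; exact: bool_irrelevance.
Qed.

Lemma padic_int_coh (x : Zp) n : (sval x n.+1 %% p ^ n)%N = sval x n.
Proof. by case: x => x /= /asboolP; exact. Qed.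

Lemma padic_int_mod (x : Zp) m n : (m <= n)%N ->
  (sval x n %% p ^ m)%N = sval x m.
Proof.
move=> /subnK <-; elim: (n - m)%N => [|k IH].
  by rewrite add0n -padic_int_coh modn_mod.
by rewrite -IH addSn -(padic_int_coh x (k + m)) modn_dvdm // dvdn_exp2l // leq_addl.
Qed.

Lemma padic_int_modn (x : Zp) n : (sval x n %% p ^ n)%N = sval x n.
Proof. exact: padic_int_mod. Qed.

Lemma padic_of_subproof (f : nat -> nat) :
  (forall n, f n.+1 = f n %[mod p ^ n]) ->
  `[< padic_coherent p (fun n => f n %% p ^ n)%N >].
Proof.
move=> h; apply/asboolP => n.
by rewrite modn_dvdm ?dvdn_exp2l// h.
Qed.

Definition padic_of f (h : forall n, f n.+1 = f n %[mod p ^ n]) : Zp :=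
  exist (fun x : nat -> nat => `[< padic_coherent p x >]) _ (padic_of_subproof h).

Lemma padic_zero_subproof n : 0 = 0 %[mod p ^ n]. Proof. by []. Qed.
Definition padic_zero : Zp := padic_of (f := fun=> 0%N) padic_zero_subproof.

Lemma padic_one_subproof n : 1 = 1 %[mod p ^ n]. Proof. by []. Qed.
Definition padic_one : Zp := padic_of (f := fun=> 1%N) padic_one_subproof.

Lemma padic_add_subproof (x y : Zp) n :
  (sval x n.+1 + sval y n.+1 = sval x n + sval y n %[mod p ^ n])%N.
Proof. by rewrite -modnDm !padic_int_coh. Qed.
Definition padic_add (x y : Zp) : Zp := padic_of (padic_add_subproof x y).

Lemma padic_mul_subproof (x y : Zp) n :
  (sval x n.+1 * sval y n.+1 = sval x n * sval y n %[mod p ^ n])%N.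
Proof. by rewrite -modnMm !padic_int_coh. Qed.
Definition padic_mul (x y : Zp) : Zp := padic_of (padic_mul_subproof x y).

Lemma padic_int_lt (x : Zp) n : (sval x n < p ^ n)%N.
Proof. by rewrite -padic_int_modn ltn_pmod// expn_gt0 prime_gt0. Qed.

Lemma padic_opp_subproof (x : Zp) n :
  (p ^ n.+1 - sval x n.+1 = p ^ n - sval x n %[mod p ^ n])%N.
Proof.
apply/eqP; rewrite -(eqn_modDr (sval x n.+1)) subnK; last first.
  exact/ltnW/padic_int_lt.
rewrite -modnDmr padic_int_coh subnK; last exact/ltnW/padic_int_lt.
by rewrite expnS modnMl modnn.
Qed.
Definition padic_opp (x : Zp) : Zp := padic_of (padic_opp_subproof x).

Lemma padic_addA : associative padic_add.
Proof.
by move=> x y z; apply: padic_int_inj => n /=; rewrite modnDml modnDmr addnA.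
Qed.

Lemma padic_addC : commutative padic_add.
Proof. by move=> x y; apply: padic_int_inj => n /=; rewrite addnC. Qed.

Lemma padic_add0 : left_id padic_zero padic_add.
Proof.
by move=> x; apply: padic_int_inj => n /=; rewrite mod0n add0n padic_int_modn.
Qed.

Lemma padic_addN : left_inverse padic_zero padic_opp padic_add.
Proof.
move=> x; apply: padic_int_inj => n /=.
by rewrite modnDml subnK ?modnn ?mod0n//; exact/ltnW/padic_int_lt.
Qed.

HB.instance Definition _ :=
  GRing.isZmodule.Build Zp padic_addA padic_addC padic_add0 padic_addN.

Lemma padic_mulA : associative padic_mul.
Proof.
by move=> x y z; apply: padic_int_inj => n /=; rewrite modnMml modnMmr mulnA.
Qed.

Lemma padic_mulC : commutative padic_mul.
Proof. by move=> x y; apply: padic_int_inj => n /=; rewrite mulnC. Qed.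

Lemma padic_mul1 : left_id padic_one padic_mul.
Proof.
by move=> x; apply: padic_int_inj => n /=; rewrite modnMml mul1n padic_int_modn.
Qed.

Lemma padic_mulDl : left_distributive padic_mul padic_add.
Proof.
move=> x y z; apply: padic_int_inj => n /=.
by rewrite modnMml modnDm mulnDl.
Qed.

Lemma padic_one_neq0 : padic_one != padic_zero.
Proof.
apply/eqP => /(congr1 (fun x : Zp => sval x 1%N)) /=.
by rewrite expn1 mod0n modn_small// prime_gt1.
Qed.

HB.instance Definition _ := GRing.Zmodule_isComNzRing.Build Zp
  padic_mulA padic_mulC padic_mul1 padic_mulDl padic_one_neq0.

Definition padic_unit : {pred Zp} := [pred x | `[< exists y : Zp, y * x = 1 >]].

Definition padic_inv (x : Zp) : Zp :=
  if pselect (exists y : Zp, y * x = 1) is left h then sval (cid h) else x.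

Lemma padic_mulV : {in padic_unit, left_inverse 1 padic_inv *%R}.
Proof.
move=> x /asboolP h; rewrite /padic_inv.
by case: pselect => [h'|/(_ h)//]; case: cid.
Qed.

Lemma padic_unitP (x y : Zp) : y * x = 1 -> padic_unit x.
Proof. by move=> yx; apply/asboolP; exists y. Qed.

Lemma padic_inv_out : {in [predC padic_unit], padic_inv =1 id}.
Proof.
move=> x nx; rewrite /padic_inv; case: pselect => // h.
by case/negP: nx; apply/asboolP.
Qed.

HB.instance Definition _ := GRing.ComNzRing_hasMulInverse.Build Zp
  padic_mulV padic_unitP padic_inv_out.

Lemma padic_int_neq0 (x : Zp) : x != 0 -> exists n, sval x n.+1 != 0%N.
Proof.
move=> x0; apply/not_existsP => h; case/eqP: x0; apply: padic_int_inj => n.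
rewrite /= mod0n; case: n => [|n]; last by have /negP/negPn/eqP := h n.
by rewrite -padic_int_modn expn0 modn1.
Qed.

(* the p-adic valuation on Z_p, with value 0 at 0 *)
Definition padic_int_val (x : Zp) : nat :=
  if pselect (exists n, sval x n.+1 != 0%N) is left h then ex_minn h else 0%N.

Lemma padic_int_valP (x : Zp) n : x != 0 ->
  (sval x n == 0%N) = (n <= padic_int_val x)%N.
Proof.
move=> /padic_int_neq0 h; rewrite /padic_int_val.
case: pselect => // h'; case: ex_minnP => v xv vmin.
case: (leqP n v) => [nv|vn]; apply/eqP.
  case: n nv => [|n] nv; first by rewrite -padic_int_modn expn0 modn1.
  by apply/eqP/negPn/negP => /vmin; rewrite leqNgt nv.
by move=> xn; move: xv; rewrite -(padic_int_mod x vn) xn mod0n.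
Qed.

Lemma padic_int_logn (x : Zp) n : x != 0 -> (padic_int_val x < n)%N ->
  (0 < sval x n)%N /\ logn p (sval x n) = padic_int_val x.
Proof.
move=> x0 vn; have xn : (0 < sval x n)%N.
  by rewrite lt0n padic_int_valP// -ltnNge.
have dv m : (m <= n)%N -> (m <= logn p (sval x n))%N = (m <= padic_int_val x)%N.
  move=> mn; rewrite -(pfactor_dvdn m hp xn) /dvdn (padic_int_mod x mn).
  exact: padic_int_valP.
split; first exact: xn.
apply/eqP; rewrite eqn_leq (dv _ (ltnW vn)) leqnn andbT.
by rewrite leqNgt (dv _ vn) ltnn.
Qed.

Lemma padic_int_val_mul (x y : Zp) : x != 0 -> y != 0 ->
  x * y != 0 /\ padic_int_val (x * y) = (padic_int_val x + padic_int_val y)%N.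
Proof.
move=> x0 y0; set v := padic_int_val x; set w := padic_int_val y.
have [xn lx] : (0 < sval x (v + w).+1)%N /\ logn p (sval x (v + w).+1) = v.
  by apply: padic_int_logn => //; rewrite ltnS leq_addr.
have [yn ly] : (0 < sval y (v + w).+1)%N /\ logn p (sval y (v + w).+1) = w.
  by apply: padic_int_logn => //; rewrite ltnS leq_addl.
have xyE k : (k <= (v + w).+1)%N -> (sval (x * y) k == 0%N) = (k <= v + w)%N.
  move=> kn; rewrite -(padic_int_mod _ kn) /= modn_dvdm ?dvdn_exp2l//.
  by rewrite -/(dvdn _ _) pfactor_dvdn ?muln_gt0 ?xn// lognM// lx ly.
have xy0 : x * y != 0.
  apply/eqP => xy0; have := xyE _ (leqnn _).
  by rewrite xy0 ltnn /= mod0n eqxx.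
split=> //; apply/eqP; rewrite eqn_leq -padic_int_valP//.
by rewrite xyE// leqnn andbT leqNgt -padic_int_valP// xyE// ltnn.
Qed.

Lemma padic_int_idomain (x y : Zp) : x * y = 0 -> (x == 0) || (y == 0).
Proof.
move=> xy; apply/negPn/negP; rewrite negb_or => /andP[x0 y0].
by have [/eqP] := padic_int_val_mul x0 y0.
Qed.

HB.instance Definition _ :=
  GRing.ComUnitRing_isIntegral.Build Zp padic_int_idomain.

Lemma padic_int_val_add (x y : Zp) : x != 0 -> y != 0 -> x + y != 0 ->
  (minn (padic_int_val x) (padic_int_val y) <= padic_int_val (x + y)%R)%N.
Proof.
move=> x0 y0 xy0; set m := minn _ _.
rewrite -padic_int_valP//=.
have /eqP -> : sval x m == 0%N by rewrite padic_int_valP// geq_minl.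
have /eqP -> : sval y m == 0%N by rewrite padic_int_valP// geq_minr.
by rewrite mod0n.
Qed.

Lemma padic_int_val_opp (x : Zp) : padic_int_val (- x) = padic_int_val x.
Proof.
have [->|x0] := eqVneq x 0; first by rewrite oppr0.
have h y : y != 0 -> (padic_int_val y <= padic_int_val (- y))%N.
  move=> y0; rewrite -padic_int_valP ?oppr_eq0//=.
  have /eqP -> : sval y (padic_int_val y) == 0%N by rewrite padic_int_valP.
  by rewrite subn0 modnn.
apply/eqP; rewrite eqn_leq h// -{2}(opprK x) h// oppr_eq0//.
Qed.

End PadicInt.

Definition padic (p : nat) (hp : prime p) : Type := {fraction padic_int hp}.

HB.instance Definition _ p (hp : prime p) := GRing.Field.on (padic hp).
HB.instance Definition _ p (hp : prime p) := isPointed.Build (padic hp) 0.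

Section PadicAbs.
Variables (p : nat) (hp : prime p).
Local Notation Qp := (padic hp).

(* Numerator and denominator of the representative chosen by {fraction _};   *)
(* padic_abs does not depend on this choice (see padic_abs_frac below).      *)
Definition padic_num (x : Qp) : padic_int hp := (frac (repr x)).1.
Definition padic_den (x : Qp) : padic_int hp := (frac (repr x)).2.

Definition padic_abs (x : Qp) : rat :=
  if x == 0 then 0
  else p%:R ^ ((padic_int_val (padic_den x))%:Z -
               (padic_int_val (padic_num x))%:Z).

Lemma padic_abs0 : padic_abs 0 = 0.
Proof. by rewrite /padic_abs eqxx. Qed.

Lemma padic_numden (x : Qp) :
  x = FracField.tofrac (padic_num x) / FracField.tofrac (padic_den x).
Proof.
have d0 : FracField.tofrac (padic_den x) != 0 :> Qp.
  by rewrite tofrac_eq0 denom_ratioP.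
apply: (mulIf d0); rewrite divfK// -{1}[x]reprK.
rewrite /padic_num /padic_den; unlock FracField.tofrac; rewrite -[LHS]FracField.pi_mul.
apply/eqmodP; rewrite /= FracField.equivfE /FracField.mulf.
rewrite !numden_Ratio ?oner_eq0 ?mulr1 ?mulf_neq0 ?oner_eq0 ?denom_ratioP//.
by rewrite mulrC.
Qed.

Lemma padic_abs_frac (a b : padic_int hp) : a != 0 -> b != 0 ->
  padic_abs (FracField.tofrac a / FracField.tofrac b) =
  p%:R ^ ((padic_int_val b)%:Z - (padic_int_val a)%:Z).
Proof.
move=> a0 b0; set x : Qp := _ / _.
have fb0 : FracField.tofrac b != 0 :> Qp by rewrite tofrac_eq0.
have x0 : x != 0 by rewrite mulf_neq0 ?invr_eq0 ?tofrac_eq0.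
rewrite /padic_abs (negbTE x0); set n := padic_num _; set d := padic_den _.
have d0 : d != 0 by rewrite denom_ratioP.
have fd0 : FracField.tofrac d != 0 :> Qp by rewrite tofrac_eq0.
have n0 : n != 0.
  apply: contra_neq x0 => n0; rewrite (padic_numden x) -/n n0.
  by rewrite tofrac0 mul0r.
have : x = FracField.tofrac n / FracField.tofrac d by exact: padic_numden.
move/eqP; rewrite /x eqr_div// -!tofracM tofrac_eq => /eqP ad.
have [_ vad] := padic_int_val_mul a0 d0.
have [_ vnb] := padic_int_val_mul n0 b0.
congr (_ ^ _); apply/eqP; rewrite subr_eq addrAC eq_sym subr_eq -!PoszD.
by rewrite -(addnC (padic_int_val n)) -vnb -ad vad addnC.
Qed.

Lemma padic_abs_ge0 (x : Qp) : 0 <= padic_abs x.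
Proof. by rewrite /padic_abs; case: ifP => // _; rewrite exprz_ge0. Qed.

Lemma padic_abs_eq0 (x : Qp) : padic_abs x = 0 -> x = 0.
Proof.
rewrite /padic_abs; case: eqP => // _ /eqP.
by rewrite expfz_eq0 pnatr_eq0 eqn0Ngt prime_gt0// andbF.
Qed.

Lemma padic_abs_opp (x : Qp) : padic_abs (- x) = padic_abs x.
Proof.
have [->|x0] := eqVneq x 0; first by rewrite oppr0.
have d0 : padic_den x != 0 by rewrite denom_ratioP.
have n0 : padic_num x != 0.
  by apply: contra_neq x0 => n0; rewrite (padic_numden x) n0 tofrac0 mul0r.
rewrite (padic_numden x) -mulNr -tofracN !padic_abs_frac ?oppr_eq0//.
by rewrite padic_int_val_opp.
Qed.

Lemma padic_common_denom (x y : Qp) : exists a b c : padic_int hp,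
  [/\ c != 0, x = FracField.tofrac a / FracField.tofrac c
    & y = FracField.tofrac b / FracField.tofrac c].
Proof.
have dx : padic_den x != 0 by rewrite denom_ratioP.
have dy : padic_den y != 0 by rewrite denom_ratioP.
exists (padic_num x * padic_den y), (padic_num y * padic_den x),
  (padic_den x * padic_den y); split; first by rewrite mulf_neq0.
- by rewrite {1}(padic_numden x) !tofracM -mulf_div divff ?mulr1// tofrac_eq0.
- rewrite {1}(padic_numden y) (mulrC (padic_den x)) !tofracM.
  by rewrite -mulf_div divff ?mulr1// tofrac_eq0.
Qed.

Lemma padic_abs_ultra (x y : Qp) :
  padic_abs (x + y) <= Num.max (padic_abs x) (padic_abs y).
Proof.
have [->|x0] := eqVneq x 0.
  by rewrite add0r le_max lexx orbT.
have [->|y0] := eqVneq y 0; first by rewrite addr0 le_max lexx.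
have [xy0|xy0] := eqVneq (x + y) 0.
  by rewrite xy0 padic_abs0 le_max padic_abs_ge0.
have [a [b [c [c0 xE yE]]]] := padic_common_denom x y.
have xyE : x + y = FracField.tofrac (a + b) / FracField.tofrac c.
  by rewrite xE yE -mulrDl tofracD.
have num_neq0 z (e : padic_int hp) : z != 0 ->
    z = FracField.tofrac e / FracField.tofrac c :> Qp -> e != 0.
  by move=> z0 zE; apply: contra_neq z0 => e0; rewrite zE e0 tofrac0 mul0r.
have a0 := num_neq0 _ _ x0 xE; have b0 := num_neq0 _ _ y0 yE.
have ab0 := num_neq0 _ _ xy0 xyE.
have p1 : 1 <= (p%:R : rat) by rewrite ler1n prime_gt0.
rewrite xyE xE yE !padic_abs_frac// le_max.
have := padic_int_val_add a0 b0 ab0; rewrite geq_min => /orP[] h.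
- by apply/orP; left; apply: ler_weXz2l => //; rewrite lerD2l lerN2 lez_nat.
- by apply/orP; right; apply: ler_weXz2l => //; rewrite lerD2l lerN2 lez_nat.
Qed.

Definition padic_dist (x y : Qp) : rat := padic_abs (x - y).

Lemma padic_distxx x : padic_dist x x = 0.
Proof. by rewrite /padic_dist subrr padic_abs0. Qed.

Lemma padic_dist_eq0 x y : padic_dist x y = 0 -> x = y.
Proof. by move/padic_abs_eq0/eqP; rewrite subr_eq0 => /eqP. Qed.

Lemma padic_dist_sym x y : padic_dist x y = padic_dist y x.
Proof. by rewrite /padic_dist -padic_abs_opp opprB. Qed.

Lemma padic_dist_triangle y x z :
  padic_dist x z <= padic_dist x y + padic_dist y z.
Proof.
rewrite /padic_dist -(subrKA y); apply: le_trans (padic_abs_ultra _ _) _.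
by rewrite ge_max lerDl lerDr !padic_abs_ge0.
Qed.

HB.instance Definition _ := isMetric.Build rat Qp
  padic_distxx padic_dist_eq0 padic_dist_sym padic_dist_triangle.

End PadicAbs.

Section PadicBorel.
Variables (p : nat) (hp : prime p) (m n : nat).
Local Notation M := 'M[padic hp]_(m, n).

HB.instance Definition _ := @isMeasurable.Build (sigma_display (@open M)) M
  <<s @open M >> (@sigma_algebra0 _ setT (@open M)) (@sigma_algebraC _ (@open M))
  (@sigma_algebra_bigcup _ setT (@open M)).

End PadicBorel.

Section PadicCharacters.
Variables (R : realType) (p : nat) (hp : prime p).
Local Notation Qp := (padic hp).

Definition padic_ball (a : Qp) (gamma : int) : set Qp :=
  [set x | padic_abs (x - a) <= p%:R ^ gamma].

(* x = \sum_(n >= v) a_n p^n with digits a_n in {0, ..., p - 1} *)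
Definition padic_expansion (x : Qp) (v : int) (a : int -> nat) : Prop :=
  (forall n, (a n < p)%N) /\
  series (fun k : nat => (a (v + k%:Z))%:R * p%:R ^ (v + k%:Z) : Qp) @ \oo --> x.

(* the fractional part {x}; for v < 0 the summation index n = v + k runs     *)
(* over v <= n <= -1                                                         *)
Definition padic_frac (x : Qp) : rat :=
  if padic_abs x <= 1 then 0
  else xget 0 [set q : rat | exists (v : int) (a : int -> nat),
    [/\ v < 0, padic_expansion x v a &
        q = \sum_(k < `|v|%N) (a (v + k%:Z))%:R * p%:R ^ (v + k%:Z)]].

Definition padic_dot m (x y : 'rV[Qp]_m) : Qp := \sum_j x 0 j * y 0 j.

(* chi_l(x) = exp (2 i pi {l . x}) *)
Definition padic_char m (l x : 'rV[Qp]_m) : R[i] :=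
  let t : R := pi *+ 2 * ratr (padic_frac (padic_dot l x)) in
  Complex (cos t) (sin t).

(* A translation-invariant Borel measure giving mass 1 to Z_p^m is finite on *)
(* compact sets, hence equal to the normalized Haar measure.                 *)
Definition is_padic_haar m (mu : {measure set 'rV[Qp]_m -> \bar R}) : Prop :=
  (forall (x : 'rV[Qp]_m) (A : set 'rV[Qp]_m), measurable A ->
     mu [set x + y | y in A] = mu A) /\
  mu [set x : 'rV[Qp]_m | forall j, padic_abs (x 0 j) <= 1] = 1%E.

End PadicCharacters.

Section L2.
Context (d : measure_display) (T : measurableType d) (R : realType).
Variables (mu : {measure set T -> \bar R}) (D : set T).
Implicit Types f g : T -> R[i].

Definition cintegral f : R[i] :=
  Complex (\int[mu]_(x in D) complex.Re (f x))
          (\int[mu]_(x in D) complex.Im (f x)).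

Definition L2sqnorm f : \bar R :=
  (\int[mu]_(x in D) ((Normc.normc (f x)) ^+ 2)%:E)%E.

Definition in_L2 f : Prop :=
  [/\ measurable_fun D (fun x => complex.Re (f x)),
      measurable_fun D (fun x => complex.Im (f x)) &
      (L2sqnorm f < +oo)%E].

Definition L2dot f g : R[i] := cintegral (fun x => f x * (g x)^*%C).

(* This is a condition on the indexed family: e i and e j must be orthogonal *)
(* for i <> j even if they agree as functions. Density of the linear span is *)
(* expressed with squared L^2 distances.                                     *)
Definition orthogonal_basis (I : Type) (A : set I) (e : I -> T -> R[i]) : Prop :=
  [/\ forall i, A i -> in_L2 (e i) /\ L2sqnorm (e i) <> 0%E,
      forall i j, A i -> A j -> i <> j -> L2dot (e i) (e j) = 0 &
      forall f, in_L2 f -> forall eps : R, 0 < eps ->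
        exists (n : nat) (i : 'I_n -> I) (c : 'I_n -> R[i]),
          (forall k, A (i k)) /\
          (L2sqnorm (fun x => f x - \sum_k c k * e (i k) x)%R < eps%:E)%E].

End L2.

Section Spectral.
Variables (R : realType) (p : nat) (hp : prime p).

Definition is_spectrum m (mu : {measure set 'rV[padic hp]_m -> \bar R})
    (Omega Lambda : set 'rV[padic hp]_m) : Prop :=
  orthogonal_basis mu Omega Lambda (@padic_char R p hp m).

Definition is_spectral_set m (mu : {measure set 'rV[padic hp]_m -> \bar R})
    (Omega : set 'rV[padic hp]_m) : Prop :=
  [/\ measurable Omega, (0 < mu Omega < +oo)%E &
      exists Lambda : set 'rV[padic hp]_m, is_spectrum mu Omega Lambda].

(* Q_p^d is identified with Q_p x Q_p^(d-1) by splitting off coordinate 0. *)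
Definition padic_cylinder d (hd : (0 < d)%N) (B : set (padic hp))
    (Theta : set 'rV[padic hp]_d.-1) : set 'rV[padic hp]_d :=
  [set x : 'rV[padic hp]_d | B (x 0 (Ordinal hd)) /\ Theta (col' (Ordinal hd) x)].

End Spectral.

(* Main.v *)
(** The zeros of the Fourier transform of the indicator of [B_gamma(a)] are the
    points of norm greater than [p^-gamma], and a character of [Q_p] restricted to
    [B_gamma(a)] depends, up to a phase, only on the class of its frequency modulo
    the dual ball [B_(-gamma)(0)].  So if [L] is a spectrum of
    [B_gamma(a) x Theta], the slice of [L] over the trivial class is orthogonal in
    [L^2(Theta)]; it is total because averaging over the first coordinate is a
    contraction that kills all the characters of the other classes.  Conversely,
    representatives of [Q_p / B_(-gamma)(0)] times a spectrum of [Theta] give a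
    spectrum of the product.

    Fubini's theorem is only needed for functions which are locally constant in the
    first coordinate; it then reduces to the uniqueness of the Haar measure, applied
    to [A |-> mu (B x A)]. *)
Require Import Defs.
From HB Require Import structures.
From mathcomp Require Import all_boot all_order all_algebra.
From mathcomp Require Import all_classical all_reals all_analysis.
From mathcomp Require Import measurable_realfun simple_functions measurable_fun_approximation.
From mathcomp.real_closed Require Import complex.
From mathcomp Require Import zify ring lra.

Set Implicit Arguments.
Unset Strict Implicit.
Unset Printing Implicit Defensive.

Import Order.TTheory GRing.Theory Num.Theory.
Import numFieldNormedType.Exports.

Local Open Scope classical_set_scope.
Local Open Scope ring_scope.

(** * p-adic absolute value and fractional part *)

(** Two features of the definitions shape the proof. [padic_frac] picks an expansion by choice, so a
    fractional part is handled only modulo the integers, through any rational n/p^k lying in x +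
    Z_p. This suffices because Z[1/p] meets Z_p in Z. And the hypotheses provide measures on Q_p^d
    and Q_p^(d-1) only, so the mass of a ball of the first coordinate is read off from [mu], as
    [cmass]. All integration in the first coordinate is finite: finitely many characters are
    simultaneously constant in that coordinate on the p^s equal pieces of B_gamma(a), for s large.
    One sum of roots of unity, [chi_sum], then does all the harmonic analysis. With the frequency
    fixed it computes Fourier transforms and averages; with the point fixed and the frequency
    running it writes the indicator of a small ball as a mean of characters. The latter gives
    totality in the converse direction: small boxes form a pi-system generating the Borel sets, and
    approximability spreads from their indicators to all of L^2. *)

Section PadicArith.
Variables (p : nat) (hp : prime p).
Local Notation Zp := (padic_int hp).
Local Notation Qp := (padic hp).
Local Notation tof := (@FracField.tofrac (padic_int hp)).
Local Notation pq := (p%:R : rat).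

Lemma p_gt0 : 0 < pq.
Proof. by rewrite ltr0n prime_gt0. Qed.

Lemma p_gt1 : 1 < pq.
Proof. by rewrite ltr1n prime_gt1. Qed.

Lemma p_neq0 : pq != 0.
Proof. by rewrite gt_eqF// p_gt0. Qed.

Lemma expp_gt0 (z : int) : 0 < pq ^ z.
Proof. by rewrite exprz_gt0// p_gt0. Qed.

Lemma ler_expp (y z : int) : (pq ^ y <= pq ^ z) = (y <= z).
Proof. by rewrite ler_eXz2l// p_gt1. Qed.

Lemma padic_num_neq0 (x : Qp) : x != 0 -> padic_num x != 0.
Proof.
move=> x0; apply: contra_neq x0 => n0.
by rewrite (padic_numden x) n0 tofrac0 mul0r.
Qed.

Lemma padic_den_neq0 (x : Qp) : padic_den x != 0.
Proof. by rewrite denom_ratioP. Qed.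

Lemma padic_absM (x y : Qp) : padic_abs (x * y) = padic_abs x * padic_abs y.
Proof.
have [->|x0] := eqVneq x 0; first by rewrite mul0r padic_abs0 mul0r.
have [->|y0] := eqVneq y 0; first by rewrite mulr0 padic_abs0 mulr0.
move: (padic_numden x) (padic_num_neq0 x0) (padic_den_neq0 x).
move: (padic_num x) (padic_den x) => a b -> a0 b0.
move: (padic_numden y) (padic_num_neq0 y0) (padic_den_neq0 y).
move: (padic_num y) (padic_den y) => c e -> c0 e0.
have [ac0 acE] := padic_int_val_mul a0 c0.
have [be0 beE] := padic_int_val_mul b0 e0.
rewrite mulf_div -!tofracM !padic_abs_frac// acE beE -expfzDr ?p_neq0//.
by rewrite !PoszD opprD addrACA.
Qed.

Lemma padic_abs_tof (a : Zp) : a != 0 ->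
  padic_abs (tof a) = pq ^ (- (padic_int_val a)%:Z).
Proof.
move=> a0; rewrite -[tof a]divr1 -tofrac1 padic_abs_frac ?oner_neq0//.
suff -> : padic_int_val (1 : Zp) = 0%N by rewrite sub0r.
have := @padic_int_val_mul p hp 1 1 (oner_neq0 _) (oner_neq0 _).
rewrite mulr1 => -[_ /eqP]; rewrite -{1}[X in X == _]addn0 eqn_add2l.
by move/eqP.
Qed.

Lemma padic_abs_tof_le (a : Zp) n :
  (padic_abs (tof a) <= pq ^ (- n%:Z)) = (sval a n == 0%N).
Proof.
have [->|a0] := eqVneq a 0.
  by rewrite tofrac0 padic_abs0 ltW ?expp_gt0//= mod0n eqxx.
by rewrite padic_abs_tof// ler_expp lerN2 lez_nat padic_int_valP.
Qed.

Lemma sval_natr (k n : nat) : sval (k%:R : Zp) n = (k %% p ^ n)%N.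
Proof.
elim: k => [|k IH]; first by rewrite mod0n /= mod0n.
by rewrite mulrS /= IH modnDm add1n.
Qed.

Lemma tof_natr k : tof k%:R = k%:R.
Proof. by rewrite rmorph_nat. Qed.

Lemma padic_abs_nat_le (k n : nat) :
  (padic_abs (k%:R : Qp) <= pq ^ (- n%:Z)) = (p ^ n %| k)%N.
Proof. by rewrite -tof_natr padic_abs_tof_le sval_natr. Qed.

Lemma padic_abs_nat_le1 (k : nat) : padic_abs (k%:R : Qp) <= 1.
Proof. by have := padic_abs_nat_le k 0; rewrite oppr0 expr0z expn0 dvd1n. Qed.

Lemma padic_abs1 : padic_abs (1 : Qp) = 1.
Proof.
have := padic_absM 1 1; rewrite mulr1 => /esym/eqP.
rewrite -{3}[padic_abs 1]mulr1 => /eqP /mulfI; apply.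
by apply/eqP => /padic_abs_eq0/eqP; rewrite oner_eq0.
Qed.

Lemma padic_abs_p : padic_abs (p%:R : Qp) = pq ^ (-1).
Proof.
rewrite -tof_natr; have p0 : (p%:R : Zp) != 0.
  (* The residue modulo p^2 is inspected because p already vanishes modulo p. *)
  apply/eqP => /(congr1 (fun x : Zp => sval x 2%N)).
  rewrite sval_natr /= mod0n modn_small.
    by move=> p0; have := prime_gt0 hp; rewrite p0.
  by rewrite expnS expn1 -[ltnLHS]muln1 ltn_pmul2l ?prime_gt1 ?prime_gt0.
rewrite padic_abs_tof//; congr (_ ^ (- _)).
apply/eqP; rewrite eqz_nat eqn_leq -ltnS ltnNge -!padic_int_valP// !sval_natr.
rewrite expn1 modnn eqxx andbT modn_small -?lt0n ?prime_gt0//.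
by rewrite expnS expn1 -[ltnLHS]muln1 ltn_pmul2l ?prime_gt1 ?prime_gt0.
Qed.

Lemma pQ_neq0 : (p%:R : Qp) != 0.
Proof.
apply/eqP => p0; have := padic_abs_p; rewrite p0 padic_abs0 => /eqP.
by rewrite lt_eqF// expp_gt0.
Qed.

Lemma padic_absV (x : Qp) : padic_abs x^-1 = (padic_abs x)^-1.
Proof.
have [->|x0] := eqVneq x 0; first by rewrite invr0 padic_abs0 invr0.
have ax0 : padic_abs x != 0 by apply: contra_neq x0; exact: padic_abs_eq0.
by apply: (mulfI ax0); rewrite -padic_absM !divff// padic_abs1.
Qed.

Lemma padic_absX (x : Qp) n : padic_abs (x ^+ n) = padic_abs x ^+ n.
Proof. by elim: n => [|n IH]; rewrite ?expr0 ?padic_abs1// !exprS padic_absM IH. Qed.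

Lemma padic_abs_expp (z : int) : padic_abs ((p%:R : Qp) ^ z) = pq ^ (- z).
Proof.
have h n : padic_abs ((p%:R : Qp) ^+ n) = pq ^ (- n%:Z).
  by rewrite padic_absX padic_abs_p exprnP exprz_exp mulN1r.
case: z => n; first exact: h.
by rewrite NegzE opprK -exprnN padic_absV h invr_expz opprK.
Qed.

Lemma padic_abs_sub (x y : Qp) : padic_abs (x - y) = padic_abs (y - x).
Proof. exact: padic_dist_sym. Qed.

Lemma padic_abs_add_le (x y : Qp) r :
  padic_abs x <= r -> padic_abs y <= r -> padic_abs (x + y) <= r.
Proof. by move=> xr yr; apply: le_trans (padic_abs_ultra _ _) _; rewrite ge_max xr. Qed.

Lemma padic_abs_sub_le (x y : Qp) r :
  padic_abs x <= r -> padic_abs y <= r -> padic_abs (x - y) <= r.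
Proof. by move=> xr yr; rewrite padic_abs_add_le// padic_abs_opp. Qed.

Lemma padic_abs_trans (z x y : Qp) r :
  padic_abs (x - z) <= r -> padic_abs (z - y) <= r -> padic_abs (x - y) <= r.
Proof. by move=> xz zy; rewrite -(subrKA z) padic_abs_add_le. Qed.

Lemma padic_abs_sum_le I (r : seq I) (P : pred I) (F : I -> Qp) (e : rat) :
  0 <= e -> (forall i, P i -> padic_abs (F i) <= e) ->
  padic_abs (\sum_(i <- r | P i) F i) <= e.
Proof.
move=> e0 h; elim/big_ind: _ => //; first by rewrite padic_abs0.
by move=> x y; exact: padic_abs_add_le.
Qed.

Lemma padic_nat_inj (s j k : nat) : (j < p ^ s)%N -> (k < p ^ s)%N ->
  padic_abs (j%:R - k%:R : Qp) <= pq ^ (- s%:Z) -> j = k.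
Proof.
wlog kj : j k / (k <= j)%N => [h js ks jk|js ks].
  case: (leqP k j) => [/h|/ltnW kj]; first exact.
  by apply/esym/h => //; rewrite padic_abs_sub.
rewrite -natrB// padic_abs_nat_le => /dvdn_leq h; apply/eqP.
rewrite eqn_leq kj andbT leqNgt -subn_gt0; apply/negP => /h.
by rewrite leqNgt (leq_ltn_trans (leq_subr _ _) js).
Qed.

Lemma sval_sub0 (x y : Zp) n : sval x n = sval y n -> sval (x - y) n = 0%N.
Proof.
move=> xy; rewrite /= -xy modnDmr subnKC ?modnn//.
exact/ltnW/padic_int_lt.
Qed.

(** In x = a/b the denominator may be divisible by p. If v is its valuation, |x| <= 1 lets p^v be
    cancelled from a and b modulo p^(v+s), and what is left of b is invertible modulo p^s. *)
Lemma padic_int_approx (x : Qp) (s : nat) : padic_abs x <= 1 ->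
  exists2 j, (j < p ^ s)%N & padic_abs (x - j%:R) <= pq ^ (- s%:Z).
Proof.
move=> x1; have [->|x0] := eqVneq x 0.
  by exists 0%N; rewrite ?expn_gt0 ?prime_gt0// subr0 padic_abs0 ltW ?expp_gt0.
move: (padic_numden x) (padic_num_neq0 x0) (padic_den_neq0 x).
move: (padic_num x) (padic_den x) => a b xE a0 b0.
set v := padic_int_val b.
have va : (v <= padic_int_val a)%N.
  move: x1; rewrite xE padic_abs_frac// -(expr0z pq) ler_expp.
  by rewrite subr_le0 lez_nat.
(* The successor keeps v < n when s = 0, as the valuation of b can only be read off from a nonzero
   residue. *)
set n := (v + s).+1.
have [bn lb] : (0 < sval b n)%N /\ logn p (sval b n) = v.
  by apply: padic_int_logn => //; rewrite /n ltnS leq_addr.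
have [b' cb bE] := pfactor_coprime hp bn.
rewrite lb in bE.
have /dvdnP[a' aE] : (p ^ v %| sval a n)%N.
  rewrite /dvdn padic_int_mod ?padic_int_valP// /n.
  by rewrite leqW// leq_addr.
have cbs : coprime b' (p ^ s) by rewrite coprime_sym coprimeXl.
(* The Chinese remainder is a multiple of b' congruent to a' modulo p^s, so its quotient by b'
   represents a'/b'. *)
pose j0 := (chinese b' (p ^ s) 0 a' %/ b')%N.
have j0E : (j0 * b' = a' %[mod p ^ s])%N.
  have bj : (b' %| chinese b' (p ^ s) 0 a')%N.
    by rewrite /dvdn chinese_modl// mod0n.
  by rewrite divnK// chinese_modr.
pose j := (j0 %% p ^ s)%N.
exists j; first by rewrite ltn_pmod// expn_gt0 prime_gt0.
have vn : (v + s <= n)%N by rewrite /n leqnSn.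
have tb0 : tof b != 0 by rewrite tofrac_eq0.
have -> : x - j%:R = tof (a - j%:R * b) / tof b.
  by rewrite xE tofracB tofracM tof_natr mulrBl mulfK.
rewrite padic_absM padic_absV (padic_abs_tof b0) -/v ler_pdivrMr ?expp_gt0//.
rewrite -expfzDr ?p_neq0// -opprD -PoszD padic_abs_tof_le addnC.
apply/eqP; apply: sval_sub0; rewrite -(padic_int_mod a vn) -(padic_int_mod (_ * b) vn).
rewrite /= modn_dvdm ?dvdn_exp2l// aE bE sval_natr -modnMml.
rewrite [(j %% _)%N]modn_small; last first.
  apply: leq_trans (_ : p ^ s <= _)%N; first by rewrite ltn_pmod// expn_gt0 prime_gt0.
  by rewrite leq_exp2l ?prime_gt1// /n leqW// leq_addl.
rewrite modnMml mulnA expnD [(p ^ v * _)%N]mulnC -!muln_modl.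
by rewrite /j modnMml j0E.
Qed.

(** The numerator is unbounded: this is a fractional part only modulo the integers, which is all
    that the exponential sees. *)
Definition pfrac (k n : nat) : rat := n%:R / pq ^+ k.

(** The residues [j s] of x/p^v modulo p^s are unique, hence coherent, and each digit is the
    quotient of [j s.+1] by p^s. *)
Lemma padic_expansion_exists (x : Qp) (v : int) : padic_abs x <= pq ^ (- v) ->
  exists a, padic_expansion x v a.
Proof.
move=> xv; pose y := x / (p%:R ^ v).
have y1 : padic_abs y <= 1.
  by rewrite padic_absM padic_absV padic_abs_expp ler_pdivrMr ?expp_gt0// mul1r.
have /choice[j jP] : forall s, exists k, (k < p ^ s)%N /\
    padic_abs (y - k%:R) <= pq ^ (- s%:Z).
  by move=> s; have [k] := padic_int_approx s y1; exists k.
have jS s : (j s.+1 = j s + p ^ s * (j s.+1 %/ p ^ s))%N.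
  rewrite [LHS](divn_eq _ (p ^ s)) addnC mulnC; congr (_ + _)%N.
  have [js ys] := jP s; have [_ yS] := jP s.+1.
  apply: (@padic_nat_inj s) => //; first by rewrite ltn_pmod// expn_gt0 prime_gt0.
  apply: (@padic_abs_trans y); last exact: ys.
  rewrite padic_abs_sub; apply: (@padic_abs_trans (j s.+1)%:R).
    by apply: le_trans yS _; rewrite ler_expp lerN2 lez_nat.
  rewrite {1}(divn_eq (j s.+1) (p ^ s)) natrD addrK padic_abs_nat_le.
  exact: dvdn_mull.
(* Below v the absolute value reflects the index; the bound on the digits is required there too, and
   still holds. *)
pose a (z : int) := (j `|z - v|.+1 %/ p ^ `|z - v|)%N.
exists a; split.
  move=> z; rewrite /a ltn_divLR ?expn_gt0 ?prime_gt0// -expnS.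
  by have [] := jP `|z - v|.+1%N.
have aE (k : nat) : a (v + k%:Z) = (j k.+1 %/ p ^ k)%N by rewrite /a addrAC subrr add0r.
have sE n : series (fun k : nat => (a (v + k%:Z))%:R * p%:R ^ (v + k%:Z) : Qp) n =
    p%:R ^ v * (j n)%:R.
  elim: n => [|n IH].
    rewrite /series /= big_geq//; have [j0 _] := jP 0%N.
    by move: j0; rewrite expn0 ltnS leqn0 => /eqP ->; rewrite mulr0.
  rewrite seriesSr IH aE [in RHS]jS natrD mulrDr; congr (_ + _).
  by rewrite expfzDr ?pQ_neq0// natrM natrX -exprnP [LHS]mulrC -mulrA.
(* The remainder has norm at most p^(-v) p^(-n), and p^n > n, so any n above p^(-v)/e will do. *)
apply/cvg_ballP => e e0; exists `|Num.ceil (e^-1 * pq ^ (- v))|%N => // n /= en.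
rewrite /ball /= /mdist /= /padic_dist sE.
have -> : x - p%:R ^ v * (j n)%:R = p%:R ^ v * (y - (j n)%:R).
  by rewrite mulrBr /y [_ * (x / _)]mulrC divfK// expfz_neq0// pQ_neq0.
have [_ yn] := jP n.
rewrite padic_absM padic_abs_expp; apply: (@le_lt_trans _ _ (pq ^ (- v) * pq ^ (- n%:Z))).
  by rewrite ler_pM2l ?expp_gt0.
rewrite -exprnN ltr_pdivrMr ?exprn_gt0 ?p_gt0// -ltr_pdivrMl//.
apply: (@le_lt_trans _ _ (`|Num.ceil (e^-1 * pq ^ (- v))|%N%:R)).
  rewrite natr_absz gtr0_norm.
    exact: Num.Theory.ceil_ge.
  by rewrite -(ltr_int rat); apply: lt_le_trans (Num.Theory.ceil_ge _); rewrite mulr_gt0 ?invr_gt0 ?expp_gt0.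
apply: (@le_lt_trans _ _ n%:R); first by rewrite ler_nat.
by rewrite -natrX ltr_nat ltn_expl// prime_gt1.
Qed.

(** The terms of exponent at least 0 lie in Z_p, so by the ultrametric inequality every later
    partial sum differs from the truncation by an element of Z_p. *)
Lemma padic_expansion_sum (x : Qp) (v : int) a : v < 0 -> padic_expansion x v a ->
  padic_abs (x - \sum_(k < `|v|%N) (a (v + k%:Z))%:R * p%:R ^ (v + k%:Z)) <= 1.
Proof.
move=> v0 [_ /cvg_ballP/(_ 1 ltr01)[N _ hN]].
have := hN (maxn N `|v|%N) (leq_maxl _ _).
rewrite /ball /= /mdist /= /padic_dist => /ltW h.
apply: (padic_abs_trans h).
pose F (k : nat) : Qp := (a (v + k%:Z))%:R * p%:R ^ (v + k%:Z).
rewrite -[X in _ - X](big_mkord predT F) /series /= -/(F _).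
rewrite (big_cat_nat _ (leq_maxr N `|v|%N))//= addrAC subrr add0r big_nat.
apply: padic_abs_sum_le => // k /andP[vk _].
rewrite padic_absM mulr_ile1 ?padic_abs_ge0 ?padic_abs_nat_le1//.
rewrite padic_abs_expp -(expr0z pq) ler_expp oppr_le0.
by rewrite -(lerD2l (- v)) addr0 addKr -ltz0_abs// lez_nat.
Qed.

(** The interface to [padic_frac]: whichever expansion was chosen, the value is some n/p^k whose
    p-adic counterpart lies in x + Z_p. *)
Lemma padic_fracP (x : Qp) : exists k n : nat, padic_frac x = pfrac k n /\
  padic_abs (x - n%:R / p%:R ^+ k) <= 1.
Proof.
rewrite /padic_frac; case: ifP => [x1|/negbT].
  by exists 0%N, 0%N; rewrite /pfrac !mul0r subr0.
rewrite -ltNge => x1.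
set S := [set q : rat | _].
have [v [v0 xv]] : exists v : int, v < 0 /\ padic_abs x <= pq ^ (- v).
  have x0 : x != 0 by apply/eqP => x0; move: x1; rewrite x0 padic_abs0 ltr10.
  move: x1; rewrite /padic_abs (negbTE x0); set z := _ - _ => z0.
  exists (- z); rewrite opprK lexx; split=> //.
  by rewrite oppr_lt0 ltNge -ler_expp expr0z -ltNge.
have [a ax] := padic_expansion_exists xv.
have : S (xget 0 S).
  by apply: (@xgetPex _ 0 S); eexists; exists v, a; split=> //.
move=> {a ax v v0 xv} [v [a [v0 ax ->]]].
have := padic_expansion_sum v0 ax.
move: ax => _; rewrite /pfrac.
exists `|v|%N, (\sum_(k < `|v|%N) a (v + k%:Z)%R * p ^ k)%N.
(* Stated over any field where p is nonzero, so that the same computation serves in the rationals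
   and in Q_p. *)
have sumE (F : fieldType) : (p%:R : F) != 0 ->
   \sum_(k < `|v|%N) (a (v + k%:Z))%:R * p%:R ^ (v + k%:Z) =
   (\sum_(k < `|v|%N) a (v + k%:Z)%R * p ^ k)%N%:R / p%:R ^+ `|v|%N :> F.
  move=> p0; rewrite natr_sum mulr_suml; apply: eq_bigr => k _.
  rewrite natrM natrX -mulrA; congr (_ * _).
  rewrite addrC expfzDr// -exprnP; congr (_ * _).
  by rewrite exprnN ltz0_abs// opprK.
by move: H; rewrite (sumE _ pQ_neq0) (sumE _ p_neq0).
Qed.

(** This is the inclusion of Z[1/p] meet Z_p in Z. The symmetry reduction lets the numerators be
    subtracted as natural numbers. *)
Lemma pfrac_congr (k n k' n' : nat) :
  padic_abs (n%:R / p%:R ^+ k - n'%:R / p%:R ^+ k' : Qp) <= 1 ->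
  exists z : int, pfrac k n = pfrac k' n' + z%:~R.
Proof.
wlog le : k n k' n' / (n' * p ^ k <= n * p ^ k')%N.
  move=> h; case: (leqP (n' * p ^ k) (n * p ^ k')) => [|/ltnW] le.
    exact: h.
  rewrite padic_abs_sub => /(h _ _ _ _ le)[z ->].
  by exists (- z); rewrite mulrNz addrK.
have subE (F : fieldType) : (p%:R : F) != 0 -> n%:R / p%:R ^+ k - n'%:R / p%:R ^+ k' =
    (n * p ^ k' - n' * p ^ k)%:R / p%:R ^+ (k + k') :> F.
  move=> p0; rewrite -mulNr addf_div ?expf_neq0// mulNr.
  by rewrite natrB// !natrM !natrX exprD.
rewrite (subE _ pQ_neq0) exprnP padic_absM padic_absV padic_abs_expp.
rewrite ler_pdivrMr ?expp_gt0// mul1r padic_abs_nat_le => /dvdnP[m mE]; exists m%:Z.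
apply/eqP; rewrite addrC -subr_eq /pfrac (subE _ p_neq0) mE natrM natrX.
by rewrite mulfK ?expf_neq0 ?p_neq0.
Qed.

(** Needed for the kernel of the character to be no larger than Z_p: if n/p^k is an integer, it is a
    natural number, itself in Z_p. *)
Lemma pfrac_int (x : Qp) (k n : nat) (z : int) :
  padic_abs (x - n%:R / p%:R ^+ k) <= 1 -> pfrac k n = z%:~R -> padic_abs x <= 1.
Proof.
move=> xn; rewrite /pfrac => zE.
have : 0 <= (z%:~R : rat) by rewrite -zE divr_ge0// exprn_ge0// ltW ?p_gt0.
rewrite ler0z; case: z zE => // m zE _.
have nE : n = (m * p ^ k)%N.
  apply/eqP; rewrite -(eqr_nat rat) natrM natrX.
  by rewrite -[m%:R]zE divfK// expf_neq0// p_neq0.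
move: xn; rewrite nE natrM natrX mulfK ?expf_neq0 ?pQ_neq0// => xm.
rewrite -(subrK (m%:R : Qp) x).
by rewrite padic_abs_add_le// padic_abs_nat_le1.
Qed.

End PadicArith.

(** * The circle exponential and the standard character of Q_p *)

Section Expi.
Variable R : realType.

Definition expi (t : R) : R[i] := Complex (cos (pi *+ 2 * t)) (sin (pi *+ 2 * t)).

Lemma expiD (s t : R) : expi (s + t) = expi s * expi t.
Proof.
rewrite /expi mulrDr cosD sinD; apply/eqP; rewrite eq_complex /= eqxx /=.
by rewrite addrC.
Qed.

Lemma expi0 : expi 0 = 1.
Proof. by rewrite /expi mulr0 cos0 sin0. Qed.

Lemma expi_int (z : int) : expi z%:~R = 1.
Proof.
have hn (n : nat) : expi n%:R = 1.
  elim: n => [|n IH]; first exact: expi0.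
  by rewrite -natr1 expiD IH mul1r /expi mulr1 cos2pi sin2pi.
case: z => n; first exact: hn.
rewrite NegzE mulrNz; have := expi0.
by rewrite -(subrr (n.+1%:R)) expiD hn mul1r.
Qed.

(** The fractional part r of t must vanish: for 0 < r < 1, sin(pi r) > 0 and cos(2 pi r) = 1 - 2
    sin(pi r)^2 < 1. *)
Lemma expi_eq1 (t : R) : expi t = 1 -> exists z : int, t = z%:~R.
Proof.
move=> t1; exists (Num.floor t); set r := t - (Num.floor t)%:~R.
have : expi r = 1 by rewrite /r -mulrNz expiD t1 expi_int mulr1.
have r0 : 0 <= r by rewrite subr_ge0 Num.Theory.floor_le.
have r1 : r < 1 by rewrite ltrBlDl -[1]/(1%:~R) -intrD Num.Theory.floorD1_gt.
move: r0; rewrite le_eqVlt => /orP[/eqP/esym/eqP|r0].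
  by rewrite subr_eq0 => /eqP.
move/(congr1 (@complex.Re R)) => /=; rewrite mulrnAl cos_mulr2n cos2sin2.
have : 0 < sin (pi * r) by rewrite sin_gt0_pi// mulr_gt0 ?pi_gt0//= gtr_pMr ?pi_gt0.
move=> /(exprn_gt0 2); move: (sin _ ^+ 2) => u u0 hu; clear -u0 hu; lra.
Qed.

Lemma normc_expi (t : R) : Normc.normc (expi t) = 1.
Proof. by rewrite /= cos2Dsin2 sqrtr1. Qed.

Lemma conj_expi (t : R) : ((expi t)^*)%C = expi (- t).
Proof. by rewrite /expi /= mulrN cosN sinN. Qed.
End Expi.

Section PadicChi.
Variables (R : realType) (p : nat) (hp : prime p).
Local Notation Qp := (padic hp).

(** The standard additive character of Q_p; [padic_char] is, by conversion, [chi] of the scalar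
    product. *)
Definition chi (t : Qp) : R[i] := expi (ratr (padic_frac t)).

(** Frees the value from the chosen expansion; additivity follows, since a sum of two approximations
    approximates the sum. *)
Lemma chiP (t : Qp) (k n : nat) :
  padic_abs (t - n%:R / p%:R ^+ k) <= 1 -> chi t = expi (ratr (pfrac p k n)).
Proof.
move=> tn; have [k' [n' [tE tn']]] := padic_fracP t.
rewrite padic_abs_sub in tn'; have [z zE] := pfrac_congr (padic_abs_trans tn' tn).
by rewrite /chi tE zE rmorphD /= ratr_int expiD expi_int mulr1.
Qed.

Lemma chiD (s t : Qp) : chi (s + t) = chi s * chi t.
Proof.
have [k [n [_ sn]]] := padic_fracP s; have [k' [n' [_ tn]]] := padic_fracP t.
rewrite (chiP sn) (chiP tn) -expiD -rmorphD.
have E (F : fieldType) : (p%:R : F) != 0 -> n%:R / p%:R ^+ k + n'%:R / p%:R ^+ k' =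
    (n * p ^ k' + n' * p ^ k)%:R / p%:R ^+ (k + k') :> F.
  move=> p0; rewrite addf_div ?expf_neq0//.
  by rewrite natrD !natrM !natrX exprD.
have -> : pfrac p k n + pfrac p k' n' = pfrac p (k + k') (n * p ^ k' + n' * p ^ k).
  by rewrite /pfrac E ?p_neq0.
by apply: chiP; rewrite -E ?pQ_neq0// opprD addrACA padic_abs_add_le.
Qed.

Lemma chi_le1 (t : Qp) : padic_abs t <= 1 -> chi t = 1.
Proof. by move=> t1; rewrite /chi /padic_frac t1 rmorph0 expi0. Qed.

Lemma chi0 : chi 0 = 1.
Proof. by rewrite chi_le1// padic_abs0 ler01. Qed.

Lemma chi_eq1 (t : Qp) : chi t = 1 -> padic_abs t <= 1.
Proof.
have [k [n [fE tn]]] := padic_fracP t.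
rewrite /chi fE => /expi_eq1[z zE]; apply: (pfrac_int tn (z := z)).
by apply: (fmorph_inj (@ratr R)); rewrite /= zE ratr_int.
Qed.

Lemma normc_chi (t : Qp) : Normc.normc (chi t) = 1.
Proof. exact: normc_expi. Qed.

Lemma chi_neq0 (t : Qp) : chi t != 0.
Proof.
apply/eqP => t0; have := normc_chi t; rewrite t0 Normc.normc0 => /eqP.
by rewrite eq_sym oner_eq0.
Qed.

Lemma chiN (t : Qp) : chi (- t) = ((chi t)^*)%C.
Proof.
apply: (mulfI (chi_neq0 t)); rewrite -chiD subrr chi0.
by rewrite /chi conj_expi -expiD subrr expi0.
Qed.

Lemma chiB (s t : Qp) : chi (s - t) = chi s * ((chi t)^*)%C.
Proof. by rewrite chiD chiN. Qed.

Lemma chiMn (t : Qp) n : chi (t *+ n) = chi t ^+ n.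
Proof. by elim: n => [|n IH]; rewrite ?chi0// mulrS chiD IH exprS. Qed.

Lemma chi_congr (s t : Qp) : padic_abs (s - t) <= 1 -> chi s = chi t.
Proof. by move=> st; rewrite -(subrK t s) chiD chi_le1 ?mul1r. Qed.

Lemma chi_sum (xi : Qp) (n : int) (s : nat) :
  padic_abs xi <= p%:R ^ (s%:Z - n) ->
  \sum_(j < p ^ s) chi (xi * (j%:R * p%:R ^ (- n))) =
  if padic_abs xi <= p%:R ^ (- n) then (p ^ s)%:R else 0.
Proof.
(* A geometric sum: [z] is a [p^s]-th root of unity. *)
move=> xis; set z := chi (xi * p%:R ^ (- n)).
have zE j : chi (xi * (j%:R * p%:R ^ (- n))) = z ^+ j.
  by rewrite mulrCA -chiMn mulr_natl.
under eq_bigr do rewrite zE.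
have absE : padic_abs (xi * p%:R ^ (- n)) = padic_abs xi * p%:R ^ n.
  by rewrite padic_absM padic_abs_expp opprK.
case: ifPn => [xin|].
  have -> : z = 1.
    apply: chi_le1; rewrite absE -ler_pdivlMr ?expp_gt0//.
    by rewrite invr_expz mul1r.
  by under eq_bigr do rewrite expr1n; rewrite sumr_const card_ord.
rewrite -ltNge => xin; have z1 : z != 1.
  apply/eqP => /chi_eq1; rewrite absE -ler_pdivlMr ?expp_gt0//.
  by rewrite invr_expz mul1r leNgt xin.
have : (z - 1) * \sum_(j < p ^ s) z ^+ j = 0.
  rewrite -subrX1 -chiMn -[_ *+ (p ^ s)%N]mulr_natl natrX.
  rewrite chi_le1 ?subrr// padic_absM absE padic_absX padic_abs_p.
  rewrite exprnP exprz_exp mulN1r mulrCA -expfzDr ?p_neq0//.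
  rewrite -ler_pdivlMr ?expp_gt0// mul1r invr_expz opprD opprK//.
by move/eqP; rewrite mulf_eq0 subr_eq0 (negbTE z1) => /eqP.
Qed.

Lemma padic_charE m (l x : 'rV[Qp]_m) : padic_char R l x = chi (padic_dot l x).
Proof. by []. Qed.

End PadicChi.

(** * Boxes in Q_p^m and Borel sets *)

Section Boxes.
Variables (p : nat) (hp : prime p).
Local Notation Qp := (padic hp).
Local Notation pq := (p%:R : rat).

Definition pbox m (c : 'rV[Qp]_m) (n : int) : set 'rV[Qp]_m :=
  [set x | forall j, padic_abs (x 0 j - c 0 j) <= pq ^ n].

Lemma pboxP m (c x : 'rV[Qp]_m) n : pbox c n x -> pbox x n = pbox c n.
Proof.
move=> xc; apply/seteqP; split=> y yx j.
  exact: (padic_abs_trans (yx j) (xc j)).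
by apply: (padic_abs_trans (yx j)); rewrite padic_abs_sub.
Qed.

Lemma pbox_sub m (c : 'rV[Qp]_m) n k : n <= k -> pbox c n `<=` pbox c k.
Proof. by move=> nk x xn j; rewrite (le_trans (xn j))// ler_expp. Qed.

Lemma expp_small (e : rat) : 0 < e -> exists n : nat, pq ^ (- n%:Z) < e.
Proof.
move=> e0; pose n := Num.trunc e^-1.
exists n.+1; rewrite -exprnN invf_plt ?posrE ?exprn_gt0 ?p_gt0//.
apply: (@lt_le_trans _ _ n.+1%:R).
  by rewrite truncnS_gt// invr_ge0 ltW.
by rewrite -natrX ler_nat ltnW// ltn_expl// prime_gt1.
Qed.

Lemma open_pboxP m (U : set 'rV[Qp]_m) :
  open U <-> forall x, U x -> exists n : nat, pbox x (- n%:Z) `<=` U.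
Proof.
rewrite openE; split=> [oU x /oU|h x /h[n xn]].
  rewrite /interior /= => /nbhs_ballP[e /= e0 xe].
  have [n ne] := expp_small e0; exists n => y yx; apply: xe.
  split=> // i j; rewrite (ord1 i) /ball /= /mdist /= /padic_dist.
  by rewrite (le_lt_trans _ ne)// padic_abs_sub.
apply/nbhs_ballP; exists (pq ^ (- n%:Z)) => /=; first exact: expp_gt0.
move=> y [_ yx]; apply: xn => j; have := yx 0 j.
by rewrite /ball /= /mdist /= /padic_dist padic_abs_sub => /ltW.
Qed.

Lemma pbox_open m (c : 'rV[Qp]_m) (n : int) : open (pbox c n).
Proof.
apply/open_pboxP => x /pboxP <-; exists `|n|%N; apply: pbox_sub.
by rewrite lerNl; case: n => k; rewrite ?NegzE ?opprK ?abszN /=; lia.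
Qed.

Lemma pbox_measurable m (c : 'rV[Qp]_m) (n : int) : measurable (pbox c n).
Proof. by apply: sub_sigma_algebra; exact: pbox_open. Qed.

(** A countable family of centres. The factor p^(-n) turns the approximation up to Z_p of
    [padic_fracP] into one up to radius p^n. *)
Definition pcenter m (q : 'rV[nat * nat]_m) (n : int) : 'rV[Qp]_m :=
  \row_j (p%:R ^ (- n) * ((q 0 j).2%:R / p%:R ^+ (q 0 j).1)).

Lemma pcenter_dense m (x : 'rV[Qp]_m) (n : int) : exists q, pbox (pcenter q n) n x.
Proof.
have /choice[f fP] : forall j : 'I_m, exists kn : nat * nat,
    padic_abs (x 0 j - p%:R ^ (- n) * (kn.2%:R / p%:R ^+ kn.1)) <= pq ^ n.
  move=> j; have [k [l [_ kl]]] := padic_fracP (p%:R ^ n * x 0 j).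
  exists (k, l) => /=.
  have -> : x 0 j = p%:R ^ (- n) * (p%:R ^ n * x 0 j).
    by rewrite mulrA -expfzDr ?pQ_neq0// addNr expr0z mul1r.
  by rewrite -mulrBr padic_absM padic_abs_expp opprK ler_piMr// ltW ?expp_gt0.
by exists (\row_j f j) => j; rewrite !mxE.
Qed.

(** Two ultrametric boxes are nested or disjoint, so adding the empty set gives a pi-system. The
    parameter [n0] discards the boxes of radius above p^(-n0), which lets the generators be as fine
    as wanted. *)
Definition pboxes m (n0 : nat) : set (set 'rV[Qp]_m) :=
  [set A | A = set0 \/ exists c (n : nat), A = pbox c (- (n0 + n)%:Z)].

Lemma pboxes_setI m n0 : setI_closed (@pboxes m n0).
Proof.
move=> A B [->|[c [n ->]]]; first by rewrite set0I; left.
move=> [->|[d [k ->]]]; first by rewrite setI0; left.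
wlog nk : c d n k / (n <= k)%N.
  move=> h; case: (leqP n k) => [|/ltnW] nk; first exact: h.
  by rewrite setIC; exact: h.
have [->|/set0P[x [xc xd]]] := eqVneq (pbox c (- (n0 + n)%:Z) `&` pbox d (- (n0 + k)%:Z)) set0.
  by left.
right; exists d, k; rewrite -(pboxP xc) -(pboxP xd); apply/setIidPr.
by apply: pbox_sub; rewrite lerN2 lez_nat leq_add2l.
Qed.

(** Second countability: an open set is the union of the small boxes it contains, and those with a
    centre in [pcenter] are countably many. *)
Lemma pboxes_measurable m n0 : @measurable _ 'rV[Qp]_m = <<s @pboxes m n0 >>.
Proof.
apply/seteqP; split; last first.
  apply: smallest_sub; first exact: sigma_algebra_measurable.
  by move=> A [->|[c [n ->]]]; [exact: measurable0|exact: pbox_measurable].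
apply: smallest_sub; first exact: smallest_sigma_algebra.
move=> U oU.
pose T := g_sigma_algebraType (@pboxes m n0).
(* [F qn] is the box of index [qn] when it fits in [U], and empty otherwise. *)
pose F (qn : 'rV[nat * nat]_m * nat) : set T :=
  let A := pbox (pcenter qn.1 (- (n0 + qn.2)%:Z)) (- (n0 + qn.2)%:Z) in
  [set x | A x /\ A `<=` U].
suff -> : U = \bigcup_qn F qn.
  apply: (@countable_bigcupT_measurable _ T); first exact: countableP.
  move=> qn; apply: sub_sigma_algebra; rewrite /F.
  set A := pbox _ _; have [AU|AU] := pselect (A `<=` U).
    by right; eexists; exists qn.2; apply/seteqP; split=> x; [case=> + _; exact|split].
  by left; apply/seteqP; split=> // x [].
apply/seteqP; split=> [x Ux|x [qn _ [Ax AU]]]; last exact: AU.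
have [n xn] := (open_pboxP U).1 oU x Ux.
have [q xq] := pcenter_dense x (- (n0 + n)%:Z).
exists (q, n) => //; split=> //=; rewrite -(pboxP xq).
by apply: subset_trans xn; apply: pbox_sub; rewrite lerN2 lez_nat leq_addl.
Qed.

(** Representatives of the box of radius p^n about 0 modulo the one of radius p^(n-s). *)
Definition pbox_offset m s (n : int) (f : {ffun 'I_m -> 'I_(p ^ s)}) : 'rV[Qp]_m :=
  \row_j ((f j)%:R * p%:R ^ (- n)).

Lemma padic_piece (x b : Qp) (n : int) (s : nat) : padic_abs (x - b) <= pq ^ n ->
  exists j : 'I_(p ^ s), padic_abs (x - (b + j%:R * p%:R ^ (- n))) <= pq ^ (n - s%:Z).
Proof.
move=> xb; have [|j js xj] := @padic_int_approx p hp ((x - b) * p%:R ^ n) s.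
  by rewrite padic_absM padic_abs_expp -ler_pdivlMr ?expp_gt0// mul1r invr_expz opprK.
exists (Ordinal js) => /=.
have -> : x - (b + j%:R * p%:R ^ (- n)) = ((x - b) * p%:R ^ n - j%:R) * p%:R ^ (- n).
  by rewrite mulrBl -mulrA -expfzDr ?pQ_neq0// subrr expr0z mulr1 opprD addrA.
by rewrite padic_absM padic_abs_expp opprK [n - _]addrC expfzDr ?p_neq0// ler_pM2r ?expp_gt0.
Qed.

Lemma padic_piece_inj (x b : Qp) (n : int) (s : nat) (i j : 'I_(p ^ s)) :
  padic_abs (x - (b + i%:R * p%:R ^ (- n))) <= pq ^ (n - s%:Z) ->
  padic_abs (x - (b + j%:R * p%:R ^ (- n))) <= pq ^ (n - s%:Z) -> i = j.
Proof.
move=> xi xj; apply: val_inj; apply: (@padic_nat_inj p hp s _ _ (ltn_ord i) (ltn_ord j)).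
rewrite padic_abs_sub in xi; have := padic_abs_trans xi xj.
rewrite opprD addrACA subrr add0r -mulrBl padic_absM padic_abs_expp opprK.
by rewrite [n - _]addrC expfzDr ?p_neq0// ler_pM2r ?expp_gt0.
Qed.

Lemma padic_piece_sub (x b : Qp) (n : int) (s : nat) (j : 'I_(p ^ s)) :
  padic_abs (x - (b + j%:R * p%:R ^ (- n))) <= pq ^ (n - s%:Z) ->
  padic_abs (x - b) <= pq ^ n.
Proof.
move=> h; apply: (@padic_abs_trans p hp (b + j%:R * p%:R ^ (- n))).
  by apply: le_trans h _; rewrite ler_expp// gerBl.
rewrite addrAC subrr add0r padic_absM padic_abs_expp opprK ler_piMl//.
  by rewrite ltW ?expp_gt0.
exact: padic_abs_nat_le1.
Qed.

Lemma pbox_split m (c : 'rV[Qp]_m) (n : int) (s : nat) :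
  pbox c n = \bigcup_(f in [set: {ffun 'I_m -> 'I_(p ^ s)}]) pbox (c + pbox_offset n f) (n - s%:Z).
Proof.
apply/seteqP; split=> [x xc|x [f _ xf] j]; last first.
  by have := xf j; rewrite !mxE; exact: padic_piece_sub.
have /choice[f fP] := fun j => padic_piece s (xc j).
by exists (finfun f) => // j; rewrite !mxE ffunE.
Qed.

Lemma pbox_split_triv m (c : 'rV[Qp]_m) (n : int) (s : nat) :
  trivIset [set: {ffun 'I_m -> 'I_(p ^ s)}] (fun f => pbox (c + pbox_offset n f) (n - s%:Z)).
Proof.
move=> f g _ _ [x [xf xg]]; apply/ffunP => j.
have := xf j; have := xg j; rewrite !mxE => xg' xf'.
exact: padic_piece_inj xf' xg'.
Qed.

End Boxes.

(** * Uniqueness of the Haar measure *)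

Lemma measure_bigcup_finType d (T : measurableType d) (R : realType)
    (mu : {measure set T -> \bar R}) (I : finType) (F : I -> set T) :
  (forall i, measurable (F i)) -> trivIset setT F ->
  mu (\bigcup_i F i) = (\sum_(i : I) mu (F i))%E.
Proof.
move=> mF tF; rewrite measure_fin_bigcup//; last exact: finite_finset.
have -> : [set: I] = [set` enum I] by apply/seteqP; split=> i //= _; rewrite mem_enum.
by rewrite -fsbig_seq ?enum_uniq// big_enum.
Qed.

Section Haar.
Variables (R : realType) (p : nat) (hp : prime p).
Local Notation Qp := (padic hp).

Definition translation_invariant m (mu : set 'rV[Qp]_m -> \bar R) :=
  forall (x : 'rV[Qp]_m) (A : set 'rV[Qp]_m), measurable A ->
    mu [set x + y | y in A] = mu A.

Lemma pbox_shift m (c d : 'rV[Qp]_m) n :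
  [set c + y | y in pbox d n] = pbox (c + d) n.
Proof.
apply/seteqP; split=> [_ [y yd <-] j|x xd].
  by rewrite !mxE opprD addrACA subrr add0r.
exists (x - c); last by rewrite addrC subrK.
by move=> j; have := xd j; rewrite !mxE opprD addrA.
Qed.

Section TranslationInvariant.
Variables (m : nat) (mu : {measure set 'rV[Qp]_m -> \bar R}).
Hypothesis muT : translation_invariant mu.

Lemma translation_invariant_pbox c n : mu (pbox c n) = mu (pbox 0 n).
Proof.
by rewrite -[in LHS](addr0 c) -pbox_shift muT//; exact: pbox_measurable.
Qed.

Lemma translation_invariant_pbox_scale c n s :
  mu (pbox c n) = (((p ^ s) ^ m)%:R%:E * mu (pbox 0 (n - s%:Z)))%E.
Proof.
rewrite (pbox_split c n s) measure_bigcup_finType//.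
- under eq_bigr do rewrite translation_invariant_pbox.
  by rewrite sumr_const cardT -cardE card_ffun !card_ord mule_natl.
- by move=> f; exact: pbox_measurable.
- exact: pbox_split_triv.
Qed.

Lemma translation_invariant_pbox_finite c n : (mu (pbox 0 0) < +oo -> mu (pbox c n) < +oo)%E.
Proof.
move=> mu0; apply: (@le_lt_trans _ _ (mu (pbox c `|n|%N%:Z))).
  apply: le_measure; rewrite ?inE; try exact: pbox_measurable.
  by apply: pbox_sub; lia.
by rewrite (translation_invariant_pbox_scale c _ `|n|%N) subrr lte_mul_pinfty ?ltry.
Qed.

Lemma translation_invariant_pbox_gt0 c n : (0 < mu (pbox 0 0) -> 0 < mu (pbox c n))%E.
Proof.
move=> mu0; apply: (@lt_le_trans _ _ (mu (pbox c (- `|n|%N%:Z)))); last first.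
  apply: le_measure; rewrite ?inE; try exact: pbox_measurable.
  by apply: pbox_sub; lia.
move: mu0; rewrite (translation_invariant_pbox_scale 0 _ `|n|%N) sub0r translation_invariant_pbox.
rewrite !lt0e => /andP[mu0 _]; rewrite measure_ge0 andbT.
by apply: contra_neq mu0 => ->; rewrite mule0.
Qed.

End TranslationInvariant.

(** The unit box is a disjoint union of p^(nm) translates of the box of radius p^(-n), so invariance
    fixes the mass of every small box; these form a generating pi-system. *)
Lemma haar_unique m (mu nu : {measure set 'rV[Qp]_m -> \bar R}) (c : {nonneg R}) :
  translation_invariant mu -> translation_invariant nu -> nu (pbox 0 0) = 1%E -> mu (pbox 0 0) = c%:num%:E ->
  forall A, measurable A -> mu A = (c%:num%:E * nu A)%E.
Proof.
move=> muT nuT nu1 muc A mA.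
(* A countable cover by unit boxes, of finite mass, as uniqueness on a pi-system requires. *)
pose g (i : nat) : set 'rV[Qp]_m :=
  if unpickle i is Some q then pbox (pcenter hp q 0) 0 else set0.
apply: (@measure_unique _ _ _ (@pboxes p hp m 0) g _ _ _ _ mu (mscale c nu)) => //.
- exact: pboxes_measurable.
- exact: pboxes_setI.
- move=> i; rewrite /g; case: unpickle => [q|]; last by left.
  by right; exists (pcenter hp q 0), 0%N; rewrite addn0 oppr0.
- apply/seteqP; split=> // x _; have [q xq] := pcenter_dense x 0.
  by exists (pickle q) => //; rewrite /g pickleK.
- move=> B [->|[b [n ->]]]; first by rewrite !measure0.
  rewrite add0n -[RHS]/(c%:num%:E * nu (pbox b (- n%:Z)))%E (translation_invariant_pbox muT) (translation_invariant_pbox nuT).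
  have := translation_invariant_pbox_scale muT 0 0 n; have := translation_invariant_pbox_scale nuT 0 0 n.
  rewrite sub0r nu1 muc; set N := _%:R => nuN muN.
  have N0 : N != 0 by rewrite pnatr_eq0 -lt0n !expn_gt0 prime_gt0.
  move/eqP: nuN; rewrite -eqe_pdivrMl// => /eqP <-.
  move/eqP: muN; rewrite -eqe_pdivrMl// => /eqP <-.
  by rewrite mule1 muleC.
- move=> i; rewrite /g; case: unpickle => [q|]; last by rewrite measure0 ltry.
  by rewrite translation_invariant_pbox// muc ltry.
Qed.

(** * Haar measure of a ball times a Borel set *)

Section Cylinders.
Variable m : nat.

Definition ptail (x : 'rV[Qp]_m.+1) : 'rV[Qp]_m := col' ord0 x.

Definition pcons (t : Qp) (y : 'rV[Qp]_m) : 'rV[Qp]_m.+1 :=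
  \row_j (if unlift ord0 j is Some k then y 0 k else t).

Lemma ptailE (x : 'rV[Qp]_m.+1) j : ptail x 0 j = x 0 (lift ord0 j).
Proof. by rewrite mxE. Qed.

Lemma pcons0 t y : pcons t y 0 ord0 = t.
Proof. by rewrite mxE unlift_none. Qed.

Lemma pconsK t y : ptail (pcons t y) = y.
Proof. by apply/rowP => j; rewrite ptailE mxE liftK. Qed.

Lemma pcons_ptail (x : 'rV[Qp]_m.+1) : pcons (x 0 ord0) (ptail x) = x.
Proof.
apply/rowP => j; rewrite mxE; case: unliftP => [k ->|-> //].
by rewrite ptailE.
Qed.

Lemma ptailD x y : ptail (x + y) = ptail x + ptail y.
Proof. by apply/rowP => j; rewrite !mxE. Qed.

Lemma ptailB x y : ptail (x - y) = ptail x - ptail y.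
Proof. by apply/rowP => j; rewrite !mxE. Qed.

Lemma ptail_measurable : measurable_fun setT ptail.
Proof.
apply: (measurability (@open 'rV[Qp]_m)) => //.
move=> _ [U oU <-]; rewrite setTI; apply: sub_sigma_algebra.
apply/open_pboxP => x /(proj1 (open_pboxP U) oU)[n xn]; exists n => y yx.
by apply: xn => j; rewrite !ptailE.
Qed.

Definition cyl (b : Qp) (n : int) (A : set 'rV[Qp]_m) : set 'rV[Qp]_m.+1 :=
  [set x : 'rV[Qp]_m.+1 | padic_abs (x 0 ord0 - b) <= p%:R ^ n /\ A (ptail x)].

Lemma cylE b n A : cyl b n A = ptail @^-1` A `&` cyl b n setT.
Proof. by apply/seteqP; split=> x; rewrite /cyl /=; tauto. Qed.

Lemma cyl_measurable b n A : measurable A -> measurable (cyl b n A).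
Proof.
move=> mA; rewrite cylE; apply: measurableI.
  by rewrite -[X in measurable X]setTI; exact: ptail_measurable.
apply: sub_sigma_algebra; apply/open_pboxP => x [xb _]; exists `|n|%N => y yx.
split=> //; apply: (padic_abs_trans _ xb); apply: le_trans (yx ord0) _.
by rewrite ler_expp//; lia.
Qed.

Lemma cyl_split b n s A :
  cyl b n A = \bigcup_(j in [set: 'I_(p ^ s)]) cyl (b + j%:R * p%:R ^ (- n)) (n - s%:Z) A.
Proof.
apply/seteqP; split=> [x [xb xA]|x [j _ [xb xA]]]; last first.
  by split=> //; exact: padic_piece_sub xb.
by have [j xj] := padic_piece s xb; exists j.
Qed.

Lemma cyl_split_triv b n s A :
  trivIset [set: 'I_(p ^ s)] (fun j => cyl (b + j%:R * p%:R ^ (- n)) (n - s%:Z) A).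
Proof. by move=> i j _ _ [x [[xi _] [xj _]]]; exact: padic_piece_inj xi xj. Qed.

Lemma cyl_shift b n A t y :
  [set pcons t y + x | x in cyl b n A] = cyl (t + b) n [set y + x | x in A].
Proof.
apply/seteqP; split=> [_ [x [xb xA] <-]|x [xb [z zA zE]]].
  split; last by rewrite ptailD pconsK; exists (ptail x).
  by rewrite mxE pcons0 opprD addrACA subrr add0r.
exists (x - pcons t y); last by rewrite addrC subrK.
split; first by rewrite !mxE unlift_none -addrA -opprD.
by rewrite ptailB pconsK -zE addrAC subrr add0r.
Qed.

Variables (mu : {measure set 'rV[Qp]_m.+1 -> \bar R}).
Variables (nu : {measure set 'rV[Qp]_m -> \bar R}).
Hypothesis muT : translation_invariant mu.
Hypothesis mu1 : mu (pbox 0 0) = 1%E.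
Hypothesis nuT : translation_invariant nu.
Hypothesis nu1 : nu (pbox 0 0) = 1%E.

(** The Haar measure p^n of a ball of radius p^n in Q_p, expressed through [mu]. Its positivity and
    its behaviour under splitting are what the sequel uses. *)
Definition cmass (n : int) : R := fine (mu (cyl 0 n (pbox 0 0))).

Lemma cmassE (b : Qp) n : mu (cyl b n (pbox 0 0)) = (cmass n)%:E.
Proof.
have -> : mu (cyl b n (pbox 0 0)) = mu (cyl 0 n (pbox 0 0)).
  rewrite -[RHS](muT (pcons b 0)); last by apply: cyl_measurable; exact: pbox_measurable.
  by rewrite cyl_shift pbox_shift !addr0.
rewrite /cmass fineK// ge0_fin_numE ?measure_ge0//.
have : (mu (pbox 0 `|n|%N%:Z) < +oo)%E by apply: translation_invariant_pbox_finite => //; rewrite mu1 ltry.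
apply: le_lt_trans; apply: le_measure; rewrite ?inE; try exact: pbox_measurable.
  by apply: cyl_measurable; exact: pbox_measurable.
move=> x [x0 xA] j; case: (unliftP ord0 j) => [k ->|->].
  apply: (@le_trans _ _ (p%:R ^ 0)); last by rewrite ler_expp//; lia.
  by have := xA k; rewrite !mxE.
by rewrite mxE; apply: (le_trans x0); rewrite ler_expp//; lia.
Qed.

Lemma cmass_gt0 n : 0 < cmass n.
Proof.
rewrite -lte_fin -(cmassE 0); have : (0 < mu (pbox 0 (- `|n|%N%:Z)))%E.
  by apply: translation_invariant_pbox_gt0 => //; rewrite mu1.
move/lt_le_trans; apply; apply: le_measure; rewrite ?inE; try exact: pbox_measurable.
  by apply: cyl_measurable; exact: pbox_measurable.
move=> x x0; split=> [|j].
  by have := x0 ord0; rewrite mxE => /le_trans; apply; rewrite ler_expp//; lia.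
have := x0 (lift ord0 j); rewrite !mxE => /le_trans; apply.
by rewrite ler_expp//; lia.
Qed.

Lemma mu_cyl b n A : measurable A -> mu (cyl b n A) = ((cmass n)%:E * nu A)%E.
Proof.
have mS : measurable (cyl b n setT) by exact: cyl_measurable.
(* Mapping A to the mass of B x A is a measure, being the image under [ptail] of [mu] restricted to
   the strip over the ball. *)
pose pushf mf : {measure set 'rV[Qp]_m -> \bar R} :=
  @measure_function_pushforward__canonical__measure_function_Measure
    _ _ _ _ _ (mrestr mu mS) ptail mf.
pose m1 := pushf ptail_measurable.
have m1E B : m1 B = mu (cyl b n B).
  by rewrite [in RHS]cylE.
move=> mA; rewrite -m1E.
have c0 : 0 <= cmass n by exact/ltW/cmass_gt0.
have m1T : translation_invariant m1.
  (* Translation by (0, x) preserves the ball factor. *)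
  move=> x B mB; rewrite !m1E -[RHS](muT (pcons 0 x)); last exact: cyl_measurable.
  by rewrite cyl_shift add0r.
apply: (@haar_unique m m1 nu (NngNum c0)) => //.
exact: etrans (m1E _) (cmassE _ _).
Qed.

Lemma cmass_split n s : cmass n = (p ^ s)%:R * cmass (n - s%:Z).
Proof.
apply: EFin_inj; rewrite -(cmassE 0) (cyl_split 0 n s) measure_bigcup_finType.
- by under eq_bigr do rewrite cmassE; rewrite sumr_const card_ord EFinM mule_natl.
- by move=> j; apply: cyl_measurable; exact: pbox_measurable.
- exact: cyl_split_triv.
Qed.

End Cylinders.

End Haar.

(** * Integration over cylinders *)

Section CylinderIntegral.
Variables (R : realType) (p : nat) (hp : prime p) (m : nat).
Local Notation Qp := (padic hp).
Variables (mu : {measure set 'rV[Qp]_m.+1 -> \bar R}).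
Variables (nu : {measure set 'rV[Qp]_m -> \bar R}).
Hypothesis muT : translation_invariant mu.
Hypothesis mu1 : mu (pbox 0 0) = 1%E.
Hypothesis nuT : translation_invariant nu.
Hypothesis nu1 : nu (pbox 0 0) = 1%E.
Local Notation cm := (cmass mu).

Lemma ge0_integral_cyl b n (A : set 'rV[Qp]_m) (g : 'rV[Qp]_m -> \bar R) :
  measurable A -> measurable_fun A g -> (forall y, A y -> 0 <= g y)%E ->
  (\int[mu]_(x in cyl b n A) g (ptail x) = (cm n)%:E * \int[nu]_(y in A) g y)%E.
Proof.
move=> mA mg g0.
have mS : measurable (cyl b n (setT : set 'rV[Qp]_m)) by exact: cyl_measurable.
have mtA : measurable (@ptail _ hp m @^-1` A).
  by rewrite -[X in measurable X]setTI; exact: ptail_measurable.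
have mtg : measurable_fun (@ptail _ hp m @^-1` A) (g \o @ptail _ hp m).
  apply: (measurable_comp mA) => //; first by move=> _ [x xA <-].
  exact: measurable_funTS (@ptail_measurable _ hp m).
pose pushf mf : {measure set 'rV[Qp]_m -> \bar R} :=
  @measure_function_pushforward__canonical__measure_function_Measure
    _ _ _ _ _ (mrestr mu mS) (@ptail _ hp m) mf.
pose m1 := pushf (@ptail_measurable _ hp m).
pose c : {nonneg R} := NngNum (ltW (cmass_gt0 muT mu1 n)).
have m1E B : measurable B -> m1 B = mscale c nu B.
  move=> mB; rewrite -[RHS]/((cm n)%:E * nu B)%E -(mu_cyl muT mu1 nuT nu1 b)//.
  by rewrite [in RHS]cylE.
transitivity (\int[m1]_(y in A) g y)%E; last first.
  rewrite (eq_measure_integral (mscale c nu)); last by move=> B mB _; exact: m1E.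
  by rewrite ge0_integral_mscale.
rewrite (ge0_integral_pushforward (@ptail_measurable _ hp m) (mrestr mu mS))//; last first.
  by move=> y; rewrite inE; exact: g0.
have mN := measurableC mS.
have N0 : mrestr mu mS (~` cyl b n setT) = 0%E by rewrite /mrestr setICl measure0.
(* Off the strip the restricted measure vanishes, so the domain can be cut down to the cylinder,
   where it agrees with [mu]. *)
rewrite [RHS](ge0_negligible_integral mN mtA mtg (fun x xA => g0 _ xA) N0).
have -> : @ptail _ hp m @^-1` A `\` ~` cyl b n setT = cyl b n A.
  by rewrite setDE setCK -cylE.
apply: eq_measure_integral => B mB BA.
rewrite /mrestr; congr (mu _); apply/esym/setIidPl => x /BA [? _]; split=> //.
Qed.

Lemma integral_cyl b n (A : set 'rV[Qp]_m) (g : 'rV[Qp]_m -> R) :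
  measurable A -> nu.-integrable A (EFin \o g) ->
  (\int[mu]_(x in cyl b n A) (g (ptail x))%:E = (cm n)%:E * \int[nu]_(y in A) (g y)%:E)%E.
Proof.
move=> mA ig; have mg := measurable_int _ ig.
rewrite integralE [in RHS]integralE muleBr//; last first.
  by rewrite fin_num_adde_defl// fin_numN; exact: integrable_neg_fin_num.
congr (_ - _)%E.
  rewrite -(ge0_integral_cyl b)//; [|exact: measurable_funepos].
  by apply: eq_integral => x _; rewrite !funeposE.
rewrite -(ge0_integral_cyl b)//; [|exact: measurable_funeneg].
by apply: eq_integral => x _; rewrite !funenegE.
Qed.

Lemma cyl_pieces b n s (A : set 'rV[Qp]_m) :
  cyl b n A = \big[setU/set0]_(j <- enum 'I_(p ^ s))
    cyl (b + j%:R * p%:R ^ (- n)) (n - s%:Z) A.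
Proof.
by rewrite (cyl_split b n s) -bigcup_seq; apply: eq_bigcupl; split=> j //= _; rewrite mem_enum.
Qed.

(** The form of Fubini used below: [h j] is the common slice of [F] over the j-th piece of the ball,
    so the outer integral is a finite sum. *)
Lemma ge0_integral_pieces b n s (A : set 'rV[Qp]_m)
    (h : 'I_(p ^ s) -> 'rV[Qp]_m -> \bar R) (F : 'rV[Qp]_m.+1 -> \bar R) :
  measurable A -> (forall j, measurable_fun A (h j)) ->
  (forall j y, A y -> 0 <= h j y)%E -> measurable_fun (cyl b n A) F ->
  (forall (j : 'I_(p ^ s)) x, cyl (b + j%:R * p%:R ^ (- n)) (n - s%:Z) A x -> F x = h j (ptail x)) ->
  (\int[mu]_(x in cyl b n A) F x =
   (cm (n - s%:Z))%:E * \sum_(j < p ^ s) \int[nu]_(y in A) h j y)%E.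
Proof.
move=> mA mh h0 mF Fh; rewrite (cyl_pieces b n s).
rewrite ge0_integral_bigsetU//=; last first.
- by rewrite -cyl_pieces => x; rewrite (cyl_split b n s) => -[j _ xj]; rewrite (Fh j)//; apply: h0; case: xj.
- by rewrite -cyl_pieces.
- by apply: sub_trivIset (@cyl_split_triv _ _ _ b n s A).
- exact: enum_uniq.
- by move=> j; exact: cyl_measurable.
rewrite big_enum/= ge0_sume_distrr; last by move=> j _; apply: integral_ge0 => y; exact: h0.
apply: eq_bigr => j _.
rewrite -(ge0_integral_cyl (b + j%:R * p%:R ^ (- n)))//; last exact: h0.
by apply: eq_integral => x; rewrite inE; exact: Fh.
Qed.

Lemma integral_pieces b n s (A : set 'rV[Qp]_m)
    (h : 'I_(p ^ s) -> 'rV[Qp]_m -> R) (F : 'rV[Qp]_m.+1 -> R) :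
  measurable A -> (forall j, nu.-integrable A (EFin \o h j)) ->
  measurable_fun (cyl b n A) F ->
  (forall (j : 'I_(p ^ s)) x, cyl (b + j%:R * p%:R ^ (- n)) (n - s%:Z) A x -> F x = h j (ptail x)) ->
  \int[mu]_(x in cyl b n A) F x =
   cm (n - s%:Z) * \sum_(j < p ^ s) \int[nu]_(y in A) h j y.
Proof.
move=> mA ih mF Fh; rewrite /Rintegral (cyl_pieces b n s).
rewrite integral_bigsetU_EFin//=; last first.
- by rewrite -cyl_pieces; exact/measurable_EFinP.
- by apply: sub_trivIset (@cyl_split_triv _ _ _ b n s A).
- exact: enum_uniq.
- by move=> j; exact: cyl_measurable.
rewrite big_enum/=.
rewrite (eq_bigr (fun j => (cm (n - s%:Z) * fine (\int[nu]_(y in A) (h j y)%:E))%:E)).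
  by rewrite sumEFin/= -mulr_sumr.
move=> j _; have hf : (\int[nu]_(y in A) (h j y)%:E)%E \is a fin_num by apply: integrable_fin_num => //; exact: ih.
rewrite EFinM (fineK hf).
rewrite -(integral_cyl (b + j%:R * p%:R ^ (- n)))//.
by apply: eq_integral => x; rewrite inE => xj; rewrite (Fh j).
Qed.

End CylinderIntegral.

(** * Closed spans in L2 *)

Section ComplexParts.
Variable R : realType.
Implicit Types z w : R[i].
Local Notation Re := (@complex.Re R).
Local Notation Im := (@complex.Im R).

Lemma creD z w : Re (z + w) = Re z + Re w. Proof. by case: z w => ? ? []. Qed.
Lemma cimD z w : Im (z + w) = Im z + Im w. Proof. by case: z w => ? ? []. Qed.
Lemma creM z w : Re (z * w) = Re z * Re w - Im z * Im w. Proof. by case: z w => ? ? []. Qed.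
Lemma cimM z w : Im (z * w) = Re z * Im w + Im z * Re w. Proof. by case: z w => ? ? []. Qed.

Lemma normc2E z : Normc.normc z ^+ 2 = Re z ^+ 2 + Im z ^+ 2.
Proof. by case: z => a b /=; rewrite sqr_sqrtr// addr_ge0 ?sqr_ge0. Qed.

Lemma normc2D z w :
  Normc.normc (z + w) ^+ 2 <= 2 * (Normc.normc z ^+ 2 + Normc.normc w ^+ 2).
Proof.
rewrite !normc2E creD cimD -subr_ge0.
set a := Re z; set b := Im z; set c := Re w; set e := Im w.
have -> : 2 * (a ^+ 2 + b ^+ 2 + (c ^+ 2 + e ^+ 2)) - ((a + c) ^+ 2 + (b + e) ^+ 2) =
  (a - c) ^+ 2 + (b - e) ^+ 2 by ring.
by rewrite addr_ge0 ?sqr_ge0.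
Qed.

End ComplexParts.

Section L2Tools.
Context (d : measure_display) (T : measurableType d) (R : realType).
Variables (mu : {measure set T -> \bar R}) (D : set T).
Hypothesis mD : measurable D.
Local Notation Re := (@complex.Re R).
Local Notation Im := (@complex.Im R).
Local Notation C := R[i].
Implicit Types f g : T -> C.

Definition cmeas f := measurable_fun D (fun x => Re (f x)) /\
  measurable_fun D (fun x => Im (f x)).

Lemma cmeasD f g : cmeas f -> cmeas g -> cmeas (fun x => f x + g x).
Proof.
move=> [f1 f2] [g1 g2]; split.
  by under eq_fun do rewrite creD; exact: measurable_funD.
by under eq_fun do rewrite cimD; exact: measurable_funD.
Qed.

Lemma cmeasM f g : cmeas f -> cmeas g -> cmeas (fun x => f x * g x).
Proof.
move=> [f1 f2] [g1 g2]; split.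
  by under eq_fun do rewrite creM; apply: measurable_funB; exact: measurable_funM.
by under eq_fun do rewrite cimM; apply: measurable_funD; exact: measurable_funM.
Qed.

Lemma cmeas_cst (c : C) : cmeas (fun=> c).
Proof. by split; exact: measurable_cst. Qed.

Lemma cmeasZ (c : C) f : cmeas f -> cmeas (fun x => c * f x).
Proof. exact/cmeasM/cmeas_cst. Qed.

Lemma cmeasB f g : cmeas f -> cmeas g -> cmeas (fun x => f x - g x).
Proof.
move=> mf mg; apply: cmeasD => //.
have -> : (fun x => - g x) = (fun x => (-1) * g x) by apply/funext => x; rewrite mulN1r.
exact: cmeasZ.
Qed.

Lemma cmeas_sum I (r : seq I) (P : pred I) (F : I -> T -> C) :
  (forall i, P i -> cmeas (F i)) -> cmeas (fun x => \sum_(i <- r | P i) F i x).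
Proof.
move=> mF; elim: r => [|i r IH].
  by under eq_fun do rewrite big_nil; exact: cmeas_cst.
under eq_fun do rewrite big_cons.
by case: (boolP (P i)) => Pi //; apply: cmeasD => //; exact: mF.
Qed.

Lemma cmeas_real (f : T -> R) : measurable_fun D f -> cmeas (fun x => (f x)%:C%C).
Proof. by move=> mf; split=> //=; exact: measurable_cst. Qed.

Lemma normc2_meas f : cmeas f ->
  measurable_fun D (fun x => ((Normc.normc (f x)) ^+ 2)%:E).
Proof.
move=> [f1 f2]; apply/measurable_EFinP; under eq_fun do rewrite normc2E.
by apply: measurable_funD; apply: measurable_funX.
Qed.

Local Notation nrm := (L2sqnorm mu D).

Lemma L2sqnorm_ge0 f : (0 <= nrm f)%E.
Proof. by apply: integral_ge0 => x _; rewrite lee_fin sqr_ge0. Qed.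

Lemma eq_L2sqnorm f g : (forall x, D x -> f x = g x) -> nrm f = nrm g.
Proof. by move=> fg; apply: eq_integral => x; rewrite inE => /fg ->. Qed.

Lemma L2sqnormZ (c : C) f : cmeas f ->
  nrm (fun x => c * f x) = ((Normc.normc c ^+ 2)%:E * nrm f)%E.
Proof.
move=> mf; rewrite /L2sqnorm -ge0_integralZl//; last 3 first.
- exact: normc2_meas.
- by move=> x _; rewrite lee_fin sqr_ge0.
- by rewrite lee_fin sqr_ge0.
by apply: eq_integral => x _; rewrite Normc.normcM exprMn EFinM.
Qed.

(** Replaces the triangle inequality for squared norms, at the price of a factor 2. *)
Lemma L2sqnormD f g : cmeas f -> cmeas g ->
  (nrm (fun x => f x + g x)%R <= 2%:E * (nrm f + nrm g))%E.
Proof.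
move=> mf mg; rewrite /L2sqnorm -ge0_integralD//; try exact: normc2_meas;
  try by move=> x _; rewrite lee_fin sqr_ge0.
rewrite -ge0_integralZl//; last 2 first.
- by apply: emeasurable_funD; exact: normc2_meas.
- by move=> x _; rewrite -EFinD lee_fin addr_ge0// sqr_ge0.
apply: ge0_le_integral => //.
- by move=> x _; rewrite lee_fin sqr_ge0.
- by apply: normc2_meas; exact: cmeasD.
- apply: measurable_funeM; apply: emeasurable_funD; exact: normc2_meas.
- by move=> x _; rewrite -EFinD -EFinM lee_fin normc2D.
Qed.

(** * Approximation by linear combinations of a family *)

Section Approx.
Variables (I : Type) (A : set I) (e : I -> T -> C).
Hypothesis me : forall i, A i -> cmeas (e i).

Definition in_span g := exists (n : nat) (i : 'I_n -> I) (c : 'I_n -> C),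
  (forall k, A (i k)) /\ forall x, g x = \sum_k c k * e (i k) x.

Definition in_closed_span f := forall eps : R, 0 < eps ->
  exists2 g, in_span g & (nrm (fun x => f x - g x)%R < eps%:E)%E.

Lemma in_span_meas g : in_span g -> cmeas g.
Proof.
move=> [n [i [c [Ai gE]]]].
have -> : g = fun x => \sum_k c k * e (i k) x by apply/funext.
by apply: cmeas_sum => k _; apply: cmeasZ; exact: me.
Qed.

Lemma in_spanD f g : in_span f -> in_span g -> in_span (fun x => f x + g x).
Proof.
move=> [n [i [c [Ai fE]]]] [n' [i' [c' [Ai' gE]]]].
exists (n + n')%N, (fun k => match fintype.split k with inl j => i j | inr j => i' j end),
  (fun k => match fintype.split k with inl j => c j | inr j => c' j end); split.
  by move=> k; case: fintype.split.
move=> x; rewrite big_split_ord fE gE; congr (_ + _); apply: eq_bigr => k _.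
  by rewrite -/(unsplit (inl k)) unsplitK.
by rewrite -/(unsplit (inr k)) unsplitK.
Qed.

Lemma in_spanZ (a : C) f : in_span f -> in_span (fun x => a * f x).
Proof.
move=> [n [i [c [Ai fE]]]]; exists n, i, (fun k => a * c k); split=> // x.
by rewrite fE mulr_sumr; apply: eq_bigr => k _; rewrite mulrA.
Qed.

Lemma in_span0 : in_span (fun=> 0).
Proof.
have i0 : 'I_0 -> I by case.
by exists 0%N, i0, (fun=> 0); split=> [[]//|x]; rewrite big_ord0.
Qed.

Lemma in_span_gen i : A i -> in_span (e i).
Proof.
move=> Ai; exists 1%N, (fun=> i), (fun=> 1); split=> // x.
by rewrite big_ord1 mul1r.
Qed.

Lemma in_span_sum J (r : seq J) (P : pred J) (F : J -> T -> C) :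
  (forall j, P j -> in_span (F j)) -> in_span (fun x => \sum_(j <- r | P j) F j x).
Proof.
move=> hF; elim: r => [|j r IH].
  by under eq_fun do rewrite big_nil; exact: in_span0.
under eq_fun do rewrite big_cons.
by case: (boolP (P j)) => Pj //; apply: in_spanD => //; exact: hF.
Qed.

Lemma eq_closed_span f g : (forall x, D x -> f x = g x) -> in_closed_span f -> in_closed_span g.
Proof.
move=> fg hf eps /hf[h sh fh]; exists h => //; rewrite -(@eq_L2sqnorm (fun x => f x - h x))//.
by move=> x Dx; rewrite fg.
Qed.

Lemma in_span_closed_span g : in_span g -> in_closed_span g.
Proof.
move=> sg eps e0; exists g => //; under eq_L2sqnorm do rewrite subrr.
rewrite /L2sqnorm integral0_eq ?lte_fin// => x _.
by rewrite Normc.normc0 expr0n.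
Qed.

Lemma closed_span_lim f : cmeas f ->
  (forall eps, 0 < eps -> exists g, [/\ cmeas g, in_closed_span g &
    (nrm (fun x => f x - g x)%R < eps%:E)%E]) -> in_closed_span f.
Proof.
(* A quarter each, because [L2sqnormD] doubles the sum of the two errors. *)
move=> mf hf eps e0; have e40 : 0 < eps / 4 by rewrite divr_gt0.
have [g [mg ag fg]] := hf _ e40; have [h sh gh] := ag _ e40.
exists h => //.
have -> : (fun x => f x - h x) = (fun x => (f x - g x) + (g x - h x)).
  by apply/funext => x; rewrite subrKA.
have mh := in_span_meas sh.
apply: (le_lt_trans (L2sqnormD (cmeasB mf mg) (cmeasB mg mh))).
have -> : eps%:E = (2%:E * ((eps / 4)%:E + (eps / 4)%:E))%E.
  by rewrite -EFinD -EFinM; congr EFin; field.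
by rewrite lte_pmul2l// lteD.
Qed.

Lemma closed_spanD f g : cmeas f -> cmeas g -> in_closed_span f -> in_closed_span g -> in_closed_span (fun x => f x + g x).
Proof.
move=> mf mg af ag eps e0; have e40 : 0 < eps / 4 by rewrite divr_gt0.
have [f' sf ff'] := af _ e40; have [g' sg gg'] := ag _ e40.
exists (fun x => f' x + g' x); first exact: in_spanD.
have -> : (fun x => f x + g x - (f' x + g' x)) = (fun x => (f x - f' x) + (g x - g' x)).
  by apply/funext => x; rewrite opprD addrACA.
have mf' := in_span_meas sf; have mg' := in_span_meas sg.
apply: (le_lt_trans (L2sqnormD (cmeasB mf mf') (cmeasB mg mg'))).
have -> : eps%:E = (2%:E * ((eps / 4)%:E + (eps / 4)%:E))%E.
  by rewrite -EFinD -EFinM; congr EFin; field.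
by rewrite lte_pmul2l// lteD.
Qed.

Lemma closed_spanZ (c : C) f : cmeas f -> in_closed_span f -> in_closed_span (fun x => c * f x).
Proof.
(* Adding 1 keeps the divisor positive when c = 0. *)
move=> mf af eps e0; pose n2 := Normc.normc c ^+ 2 + 1.
have n20 : 0 < n2 by rewrite ltr_wpDl// sqr_ge0.
have [g sg fg] := af _ (divr_gt0 e0 n20).
exists (fun x => c * g x); first exact: in_spanZ.
have -> : (fun x => c * f x - c * g x) = (fun x => c * (f x - g x)).
  by apply/funext => x; rewrite mulrBr.
rewrite L2sqnormZ; last exact: cmeasB (in_span_meas sg).
apply: (@le_lt_trans _ _ (n2%:E * nrm (fun x => (f x - g x)%R))%E).
  by apply: lee_wpmul2r; [exact: L2sqnorm_ge0|rewrite lee_fin lerDl].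
by rewrite muleC -lte_pdivlMr// EFinM in fg *.
Qed.

Lemma closed_span_sum J (r : seq J) (P : pred J) (F : J -> T -> C) :
  (forall j, P j -> cmeas (F j)) -> (forall j, P j -> in_closed_span (F j)) ->
  in_closed_span (fun x => \sum_(j <- r | P j) F j x).
Proof.
move=> mF aF; elim: r => [|j r IH].
  by under eq_fun do rewrite big_nil; exact/in_span_closed_span/in_span0.
under eq_fun do rewrite big_cons.
case: (boolP (P j)) => Pj //; apply: closed_spanD => //; [exact: mF|exact: cmeas_sum|exact: aF].
Qed.

Definition cindic (B : set T) (x : T) : C := (\1_B x)%:C%C.

Lemma cindic_meas B : measurable B -> cmeas (cindic B).
Proof. by move=> mB; apply: cmeas_real; exact: measurable_indic. Qed.

Lemma L2sqnorm_indic B : measurable B -> nrm (cindic B) = mu (B `&` D).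
Proof.
move=> mB; rewrite -integral_indic//; apply: eq_integral => x _.
by rewrite normc2E /= expr0n addr0 indicE; case: (x \in B); rewrite ?expr1n ?expr0n.
Qed.

Lemma cindicD A1 A2 : A2 `<=` A1 ->
  cindic (A1 `\` A2) = fun x => cindic A1 x - cindic A2 x.
Proof.
move=> A21; apply/funext => x; rewrite /cindic -rmorphB; congr (_%:C)%C.
rewrite !indicE in_setD; have [x2|x2] := boolP (x \in A2); last by rewrite andbT subr0.
by rewrite andbF (mem_set (A21 _ (set_mem x2))) subrr.
Qed.

(** The measurable sets with approximable indicator form a lambda-system: proper differences are
    linear, and increasing unions converge in L^2 because [D] has finite measure. *)
Lemma closed_span_indic G : (mu D < +oo)%E -> setI_closed G -> @measurable d T = <<s G>> ->
  in_closed_span (cindic setT) -> (forall B, G B -> in_closed_span (cindic B)) ->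
  forall B, measurable B -> in_closed_span (cindic B).
Proof.
move=> Dfin GI GE aT aG B mB.
suff: <<s G>> `<=` [set B | measurable B /\ in_closed_span (cindic B)].
  by rewrite -GE => /(_ _ mB)[].
apply: lambda_system_subset; [exact: GI| | |by []].
- split; [by []|by []| |].
  + move=> A1 A2 A21 [m1 a1] [m2 a2]; split; first exact: measurableD.
    rewrite cindicD//.
    have -> : (fun x => cindic A1 x - cindic A2 x) =
        (fun x => cindic A1 x + (-1) * cindic A2 x).
      by apply/funext => x; rewrite mulN1r.
    apply: closed_spanD => //; [exact: cindic_meas|exact/cmeasZ/cindic_meas|].
    by apply: closed_spanZ => //; exact: cindic_meas.
  + move=> F ndF hF; have mF i : measurable (F i) by case: (hF i).
    have mUF : measurable (\bigcup_i F i) by exact: bigcup_measurable.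
    split=> //; apply: closed_span_lim; first exact: cindic_meas.
    (* The mass of [E n] is the squared distance from the indicator of the union to that of [F n];
       the [E n] decrease to the empty set. *)
    move=> eps e0; pose E n := (\bigcup_i F i `\` F n) `&` D.
    have mE n : measurable (E n) by apply: measurableI => //; exact: measurableD.
    have : mu \o E @ \oo --> mu (\bigcap_n E n).
      apply: nonincreasing_cvg_mu => //.
      * by apply: le_lt_trans Dfin; apply: le_measure; rewrite ?inE// => x [].
      * exact: bigcapT_measurable.
      * move=> m n mn; apply/subsetPset; apply: setSI; apply: setDS.
        exact/subsetPset/ndF.
    have -> : \bigcap_n E n = set0.
      rewrite -subset0 => x Ex; have [[[n _ Fx] _] _] := Ex 0%N Logic.I.
      by have [[_ /(_ Fx)]] := Ex n Logic.I.
    rewrite measure0 => /fine_cvgP[_ /cvgrPdist_lt/(_ _ e0)[N _ hN]].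
    have := hN N (leqnn N); rewrite sub0r normrN ger0_norm; last by rewrite fine_ge0.
    move=> muE; exists (cindic (F N)); split; [exact: cindic_meas|by case: (hF N)|].
    rewrite -cindicD; last exact: bigcup_sup.
    rewrite L2sqnorm_indic; last exact: measurableD.
    rewrite -/(E N) -[mu (E N)]fineK ?lte_fin// ge0_fin_numE//.
    by apply: le_lt_trans Dfin; apply: le_measure; rewrite ?inE// => x [].
- by move=> A1 GA; split; [rewrite GE; exact: sub_sigma_algebra|exact: aG].
Qed.

Import HBNNSimple.

Lemma closed_span_nnsfun (h : {nnsfun T >-> R}) :
  (forall B, measurable B -> in_closed_span (cindic B)) -> in_closed_span (fun x => (h x)%:C%C).
Proof.
move=> aB; pose s := finmap.enum_fset (fset_set (range h)).
have -> : (fun x => (h x)%:C%C) =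
    (fun x => \sum_(y <- s) (y%:C%C * cindic (h @^-1` [set y]) x)).
  apply/funext => x; rewrite fimfunE fsbig_finite// rmorph_sum.
  by apply: eq_bigr => y _; rewrite rmorphM.
have my y : cmeas (cindic (h @^-1` [set y])) by exact: cindic_meas.
apply: closed_span_sum => y _; first exact: cmeasZ.
by apply: closed_spanZ => //; exact: aB.
Qed.

(** Simple functions h_n increase to f with 0 <= h_n <= f, so f^2 dominates (f - h_n)^2 and
    dominated convergence gives convergence in L^2. *)
Lemma closed_span_ge0 (f : T -> R) : (forall B, measurable B -> in_closed_span (cindic B)) ->
  measurable_fun D f -> (forall x, D x -> 0 <= f x) ->
  (\int[mu]_(x in D) ((f x) ^+ 2)%:E < +oo)%E -> in_closed_span (fun x => (f x)%:C%C).
Proof.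
move=> aB mf f0 foo; apply: closed_span_lim; first exact: cmeas_real.
move=> eps e0; have mF : measurable_fun D (EFin \o f) by exact/measurable_EFinP.
pose h n := nnsfun_approx mD mF n.
have hf n x : D x -> h n x <= f x.
  move=> Dx; rewrite -lee_fin /h nnsfun_approxE.
  by apply: (le_approx _ _ Dx) => y Dy; rewrite lee_fin f0.
have mh n : measurable_fun D (h n) by exact: measurable_funTS.
have mu_ n : measurable_fun D (fun x => ((f x - h n x) ^+ 2)%:E).
  by apply/measurable_EFinP/measurable_funX/measurable_funB.
have cvg_ x : D x -> (fun n => ((f x - h n x) ^+ 2)%:E) @ \oo --> 0%E.
  move=> Dx; apply/fine_cvgP; split; first exact: nearW.
  have hx : h n x @[n --> \oo] --> f x.
    rewrite /h; under eq_fun do rewrite nnsfun_approxE.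
    apply: (cvg_approx (f := EFin \o f)) => //=; rewrite ?ltry//.
  have fhx : f x - h n x @[n --> \oo] --> 0.
    have c : (fun _ : nat => f x) @ \oo --> f x by exact: cvg_cst.
    by rewrite -[X in _ --> X](subrr (f x)); exact: (cvgB c hx).
  have -> : fine \o (fun n => ((f x - h n x) ^+ 2)%:E) =
    (fun n => (f x - h n x) * (f x - h n x)) by apply/funext => n /=; rewrite expr2.
  by rewrite -(mulr0 0); exact: cvgM.
have ig : mu.-integrable D (fun x => ((f x) ^+ 2)%:E).
  apply/integrableP; split; first exact/measurable_EFinP/measurable_funX.
  by under eq_integral do rewrite gee0_abs ?lee_fin ?sqr_ge0//.
have mz : measurable_fun D (fun=> 0%E : \bar R) by exact: measurable_cst.
have dom : {ae mu, forall x n, D x ->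
    (`|((f x - h n x) ^+ 2)%:E| <= ((f x) ^+ 2)%:E)%E}.
  apply: aeW => x n Dx; rewrite gee0_abs ?lee_fin ?sqr_ge0//.
  have h0 : 0 <= h n x by exact: fun_ge0.
  by rewrite ler_sqr ?nnegrE ?subr_ge0 ?hf ?f0// gerBl.
have [_ _ +] := dominated_convergence mD mu_ mz (aeW mu cvg_) ig dom.
rewrite integral0 => /fine_cvgP[/= [N1 _ hN1]] /cvgrPdist_lt/(_ _ e0)[N2 _ hN2].
pose N := maxn N1 N2; have := hN2 N (leq_maxr _ _); have := hN1 N (leq_maxl _ _).
rewrite /= => fN; rewrite sub0r normrN => hN.
exists (fun x => (h N x)%:C%C); split; first exact: cmeas_real.
  exact: closed_span_nnsfun.
rewrite -lte_fin in hN; apply: le_lt_trans hN.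
rewrite ger0_norm ?fine_ge0 ?fineK//; last first.
  by apply: integral_ge0 => x _; rewrite lee_fin sqr_ge0.
rewrite le_eqVlt; apply/orP; left; apply/eqP; apply: eq_integral => x _.
by rewrite normc2E creD cimD /= oppr0 addr0 expr0n addr0.
Qed.

(** The positive and negative parts of the real and imaginary parts of f are all bounded by |f|,
    hence square integrable. *)
Lemma closed_span_in_L2 f : (forall B, measurable B -> in_closed_span (cindic B)) ->
  in_L2 mu D f -> in_closed_span f.
Proof.
move=> aB [f1 f2 foo].
have key (g : T -> R) : measurable_fun D g ->
    (forall x, g x ^+ 2 <= Normc.normc (f x) ^+ 2) -> in_closed_span (fun x => (g x)%:C%C).
  move=> mg gf.
  have h (u : T -> R) : measurable_fun D u -> (forall x, 0 <= u x <= `|g x|) ->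
      in_closed_span (fun x => (u x)%:C%C).
    move=> mu_ ug; apply: closed_span_ge0 => //; first by move=> x _; case/andP: (ug x).
    apply: le_lt_trans foo; apply: ge0_le_integral => //.
    - by move=> x _; rewrite lee_fin sqr_ge0.
    - exact/measurable_EFinP/measurable_funX.
    - exact: normc2_meas.
    - move=> x _; rewrite lee_fin; apply: le_trans (gf x); rewrite -[leRHS]real_normK ?num_real//.
      by case/andP: (ug x) => u0 ux; rewrite ler_sqr ?nnegrE.
  have -> : (fun x => (g x)%:C%C) = (fun x => ((g^\+)%R x)%:C%C + (-1) * ((g^\-)%R x)%:C%C).
    apply/funext => x; rewrite mulN1r -rmorphB; congr (_%:C)%C.
    by rewrite -[in LHS](funrposBneg g).
  have mp : measurable_fun D (g^\+)%R by exact: measurable_funrpos.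
  have mn : measurable_fun D (g^\-)%R by exact: measurable_funrneg.
  apply: closed_spanD; [exact: cmeas_real|exact/cmeasZ/cmeas_real| |].
    apply: h => // x; rewrite funrpos_ge0/=.
    by rewrite /funrpos ge_max ler_norm normr_ge0.
  apply: closed_spanZ; first exact: cmeas_real.
  apply: h => // x; rewrite funrneg_ge0/=.
  by rewrite /funrneg ge_max -normrN ler_norm normr_ge0.
have -> : f = (fun x => (Re (f x))%:C%C + Complex 0 1 * (Im (f x))%:C%C).
  apply/funext => x; case: (f x) => a b; apply/eqP; rewrite eq_complex creD cimD creM cimM /=.
  by rewrite !mulr0 mul0r !mul1r subr0 addr0 !add0r !eqxx.
apply: closed_spanD; [exact: cmeas_real|exact/cmeasZ/cmeas_real| |].
  by apply: key => // x; rewrite normc2E lerDl sqr_ge0.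
apply: closed_spanZ; first exact: cmeas_real.
by apply: key => // x; rewrite normc2E lerDr sqr_ge0.
Qed.

End Approx.
End L2Tools.

(** * Characters of Q_p^m *)

Section Characters.
Variables (R : realType) (p : nat) (hp : prime p).
Local Notation Qp := (padic hp).
Local Notation ch := (@padic_char R p hp _).

Lemma padic_dotBl m (l l' x : 'rV[Qp]_m) :
  padic_dot (l - l') x = padic_dot l x - padic_dot l' x.
Proof. by rewrite /padic_dot -sumrB; apply: eq_bigr => j _; rewrite !mxE mulrBl. Qed.

Lemma padic_dotBr m (l x x' : 'rV[Qp]_m) :
  padic_dot l (x - x') = padic_dot l x - padic_dot l x'.
Proof. by rewrite /padic_dot -sumrB; apply: eq_bigr => j _; rewrite !mxE mulrBr. Qed.

Lemma padic_char_ptail m (l x : 'rV[Qp]_m.+1) :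
  ch l x = chi R (l 0 ord0 * x 0 ord0) * ch (ptail l) (ptail x).
Proof.
rewrite !padic_charE /padic_dot big_ord_recl chiD; congr (_ * chi _ _).
by apply: eq_bigr => j _; rewrite !ptailE.
Qed.

Lemma padic_charB m (l l' x : 'rV[Qp]_m) : ch (l - l') x = ch l x * ((ch l' x)^*)%C.
Proof. by rewrite !padic_charE padic_dotBl chiB. Qed.

Lemma normc_padic_char m (l x : 'rV[Qp]_m) : Normc.normc (ch l x) = 1.
Proof. by rewrite padic_charE normc_chi. Qed.

Lemma padic_bound (I : finType) (f : I -> Qp) :
  exists n : nat, forall i, padic_abs (f i) <= p%:R ^ n%:Z.
Proof.
have h x : exists n : nat, padic_abs (x : Qp) <= p%:R ^ n%:Z.
  have x0 : 0 < (padic_abs x + 1)^-1 by rewrite invr_gt0 ltr_wpDl// padic_abs_ge0.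
  have [n nx] := expp_small hp x0; exists n.
  move: nx; rewrite -exprnN ltf_pV2 ?posrE ?exprn_gt0 ?p_gt0//; last first.
    by rewrite ltr_wpDl// padic_abs_ge0.
  by move/ltW; apply: le_trans; rewrite lerDl.
have /choice[g gP] := fun i => h (f i).
exists (\max_i g i)%N => i; apply: le_trans (gP i) _.
by rewrite ler_expp// lez_nat leq_bigmax.
Qed.

Lemma loc_cst_measurable m d (T : measurableType d) (D : set 'rV[Qp]_m) (f : 'rV[Qp]_m -> T) :
  (forall x, exists n : nat, forall y, pbox x (- n%:Z) y -> f y = f x) ->
  measurable_fun D f.
Proof.
move=> hf mD B mB; apply: measurableI => //; apply: sub_sigma_algebra.
apply/open_pboxP => x fx; have [n hn] := hf x; exists n => y /hn.
by rewrite /preimage /= => ->.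
Qed.

Lemma padic_char_loc_cst m (l x : 'rV[Qp]_m) :
  exists n : nat, forall y, pbox x (- n%:Z) y -> ch l y = ch l x.
Proof.
have [n ln] := padic_bound (fun j => l 0 j).
exists n => y yx; rewrite !padic_charE; apply: chi_congr; rewrite -padic_dotBr.
apply: padic_abs_sum_le => // j _; rewrite padic_absM !mxE.
apply: (@le_trans _ _ (p%:R ^ n%:Z * p%:R ^ (- n%:Z))).
  by apply: ler_pM; rewrite ?padic_abs_ge0.
by rewrite -expfzDr ?p_neq0// subrr expr0z.
Qed.

Lemma padic_char_meas m (D : set 'rV[Qp]_m) l : cmeas D (ch l).
Proof.
by split; apply: loc_cst_measurable => x; have [n hn] := padic_char_loc_cst l x;
  exists n => y /hn ->.
Qed.

Section OneMeasure.
Variables (m : nat) (mu : {measure set 'rV[Qp]_m -> \bar R}) (D : set 'rV[Qp]_m).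
Hypothesis mD : measurable D.
Hypothesis Dfin : (mu D < +oo)%E.

Lemma L2sqnorm_char l : L2sqnorm mu D (ch l) = mu D.
Proof.
rewrite /L2sqnorm; under eq_integral do rewrite normc_padic_char expr1n.
by rewrite integral_cst// mul1e.
Qed.

Lemma padic_char_in_L2 l : in_L2 mu D (ch l).
Proof. by have [h1 h2] := padic_char_meas D l; split=> //; rewrite L2sqnorm_char. Qed.

Lemma L2dot_char l l' : L2dot mu D (ch l) (ch l') = cintegral mu D (ch (l - l')).
Proof. by congr (cintegral _ _ _); apply/funext => x; rewrite padic_charB. Qed.

Lemma padic_char_int l : mu.-integrable D (EFin \o (fun x => complex.Re (ch l x))) /\
  mu.-integrable D (EFin \o (fun x => complex.Im (ch l x))).
Proof.
have [m1 m2] := padic_char_meas D l.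
have h (g : 'rV[Qp]_m -> R) : measurable_fun D g -> (forall x, `|g x| <= 1) ->
    mu.-integrable D (EFin \o g).
  move=> mg g1; apply: measurable_bounded_integrable => //.
  by exists 1; split=> // M M1 x _ /=; rewrite (le_trans (g1 x))// ltW.
have n1 x : complex.Re (ch l x) ^+ 2 + complex.Im (ch l x) ^+ 2 = 1.
  by rewrite -normc2E normc_padic_char expr1n.
split; apply: h => // x; rewrite -(@ler_sqr _ _ 1) ?nnegrE// expr1n real_normK ?num_real//.
  by rewrite -(n1 x) lerDl sqr_ge0.
by rewrite -(n1 x) lerDr sqr_ge0.
Qed.

Lemma cintegralZ_char (w : R[i]) l :
  cintegral mu D (fun x => w * ch l x) = w * cintegral mu D (ch l).
Proof.
have [i1 i2] := padic_char_int l.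
have Z (r : R) (g : 'rV[Qp]_m -> R) : mu.-integrable D (EFin \o g) ->
    mu.-integrable D (EFin \o (fun x => r * g x)).
  by move=> ig; have := integrableZl mD r ig.
apply/eqP; rewrite eq_complex creM cimM /cintegral /=; apply/andP; split; apply/eqP.
  under eq_Rintegral do rewrite creM.
  by rewrite RintegralB ?RintegralZl//; apply: Z.
under eq_Rintegral do rewrite cimM.
by rewrite RintegralD ?RintegralZl//; apply: Z.
Qed.

End OneMeasure.
End Characters.

(** * Spectra of cylinders *)

Lemma sqr_sum_le (R : realFieldType) (n : nat) (x : 'I_n -> R) :
  (\sum_j x j) ^+ 2 <= n%:R * \sum_j x j ^+ 2.
Proof.
case: n x => [|n] x; first by rewrite !big_ord0 expr0n mulr0.
set N : R := n.+1%:R; set S := \sum_j x j; set Q := \sum_j x j ^+ 2.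
have N0 : 0 < N by rewrite ltr0n.
(* The variance is nonnegative. *)
have : 0 <= \sum_j (N * x j - S) ^+ 2 by apply: sumr_ge0 => j _; exact: sqr_ge0.
have -> : \sum_j (N * x j - S) ^+ 2 = N * (N * Q - S ^+ 2).
  have sqE j : (N * x j - S) ^+ 2 = N ^+ 2 * x j ^+ 2 - 2 * N * S * x j + S ^+ 2 by ring.
  under eq_bigr do rewrite sqE.
  rewrite big_split sumrB /= -!mulr_sumr sumr_const card_ord -/S -/Q -/N.
  by rewrite -[_ *+ _]mulr_natl -/N; ring.
by rewrite pmulr_rge0// subr_ge0.
Qed.

Lemma normc2_sum_le (R : realType) (n : nat) (z : 'I_n -> R[i]) :
  Normc.normc (\sum_j z j) ^+ 2 <= n%:R * \sum_j Normc.normc (z j) ^+ 2.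
Proof.
under [X in _ * X]eq_bigr do rewrite normc2E.
rewrite normc2E big_split mulrDr lerD//=.
  by rewrite (big_morph _ (@creD R) (erefl : complex.Re (0 : R[i]) = 0)) sqr_sum_le.
by rewrite (big_morph _ (@cimD R) (erefl : complex.Im (0 : R[i]) = 0)) sqr_sum_le.
Qed.

Section Cylinder.
Variables (R : realType) (p : nat) (hp : prime p) (m : nat).
Local Notation Qp := (padic hp).
Local Notation ch := (@padic_char R p hp _).
Local Notation pq := (p%:R : rat).
Variables (mu : {measure set 'rV[Qp]_m.+1 -> \bar R}).
Variables (nu : {measure set 'rV[Qp]_m -> \bar R}).
Hypothesis muT : translation_invariant mu.
Hypothesis mu1 : mu (pbox 0 0) = 1%E.
Hypothesis nuT : translation_invariant nu.
Hypothesis nu1 : nu (pbox 0 0) = 1%E.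
Variables (a : Qp) (gamma : int) (Theta : set 'rV[Qp]_m).
Hypothesis mTheta : measurable Theta.
Hypothesis Tfin : (nu Theta < +oo)%E.
Local Notation Omega := (cyl a gamma Theta).
Local Notation cm := (cmass mu).

Let cm_gt0 n : 0 < cm n. Proof. exact: cmass_gt0. Qed.

Lemma Omega_measurable : measurable Omega. Proof. exact: cyl_measurable. Qed.

Lemma Omega_fin : (mu Omega < +oo)%E.
Proof. by rewrite (mu_cyl muT mu1 nuT nu1)// lte_mul_pinfty// lee_fin ltW ?cm_gt0. Qed.

Lemma padic_exp_bound (x : Qp) : exists s : nat, padic_abs x <= pq ^ (s%:Z - gamma).
Proof.
have [n xn] := padic_bound (fun _ : 'I_1 => x); exists (n + `|gamma|)%N.
by apply: (le_trans (xn ord0)); rewrite ler_expp//; lia.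
Qed.

Lemma chi_piece (t x b : Qp) (s : nat) : padic_abs t <= pq ^ (s%:Z - gamma) ->
  padic_abs (x - b) <= pq ^ (gamma - s%:Z) -> chi R (t * x) = chi R (t * b).
Proof.
move=> ts xb; apply: chi_congr; rewrite -mulrBr padic_absM.
apply: (@le_trans _ _ (pq ^ (s%:Z - gamma) * pq ^ (gamma - s%:Z))).
  by apply: ler_pM; rewrite ?padic_abs_ge0.
by rewrite -expfzDr ?p_neq0// addrA subrK subrr expr0z.
Qed.

(** The Fourier transform of the indicator of a product factors. On each piece of radius p^(gamma-s)
    the head character is a constant phase [w j], and [chi_sum] adds up the phases. *)
Lemma cintegral_cyl (l : 'rV[Qp]_m.+1) :
  cintegral mu Omega (ch l) =
  if padic_abs (l 0 ord0) <= pq ^ (- gamma)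
  then (cm gamma)%:C%C * chi R (l 0 ord0 * a) * cintegral nu Theta (ch (ptail l)) else 0.
Proof.
have [s ls] := padic_exp_bound (l 0 ord0).
pose w (j : 'I_(p ^ s)) := chi R (l 0 ord0 * (a + j%:R * p%:R ^ (- gamma))).
pose K := ch (ptail l).
have [iK1 iK2] := padic_char_int mTheta Tfin (ptail l).
have Z (r : R) (g : 'rV[Qp]_m -> R) : nu.-integrable Theta (EFin \o g) ->
    nu.-integrable Theta (EFin \o (fun x => r * g x)).
  by move=> ig; have := integrableZl mTheta r ig.
have chw (j : 'I_(p ^ s)) x :
    cyl (a + j%:R * p%:R ^ (- gamma)) (gamma - s%:Z) Theta x -> ch l x = w j * K (ptail x).
  by move=> [xj _]; rewrite padic_char_ptail (chi_piece ls xj).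
have [m1 m2] := padic_char_meas R Omega l.
have -> : cintegral mu Omega (ch l) =
    (cm (gamma - s%:Z))%:C%C * \sum_j cintegral nu Theta (fun y => w j * K y).
  apply/eqP; rewrite eq_complex creM cimM /= !mul0r subr0 addr0; apply/andP; split; apply/eqP.
    rewrite (integral_pieces muT mu1 nuT nu1 (s := s)
      (h := fun j y => complex.Re (w j * K y)) mTheta)//.
    - by congr (_ * _); rewrite (big_morph _ (@creD R) (erefl : complex.Re (0 : R[i]) = 0)).
    - move=> j; under eq_fun do rewrite creM.
      exact: (integrableB mTheta (Z _ _ iK1) (Z _ _ iK2)).
    - by move=> j x xj; exact: (congr1 (@complex.Re R) (chw j x xj)).
  rewrite (integral_pieces muT mu1 nuT nu1 (s := s)
      (h := fun j y => complex.Im (w j * K y)) mTheta)//.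
  - by congr (_ * _); rewrite (big_morph _ (@cimD R) (erefl : complex.Im (0 : R[i]) = 0)).
  - move=> j; under eq_fun do rewrite cimM.
    exact: (integrableD mTheta (Z _ _ iK2) (Z _ _ iK1)).
  - by move=> j x xj; exact: (congr1 (@complex.Im R) (chw j x xj)).
under eq_bigr do rewrite cintegralZ_char//.
rewrite -mulr_suml.
have -> : \sum_j w j = chi R (l 0 ord0 * a) *
    if padic_abs (l 0 ord0) <= pq ^ (- gamma) then (p ^ s)%:R else 0.
  rewrite -(chi_sum R ls) mulr_sumr; apply: eq_bigr => j _.
  by rewrite -chiD -mulrDr.
case: ifP => _; last by rewrite mulr0 mul0r mulr0.
rewrite (cmass_split muT mu1 gamma s) [_%:R * _]mulrC rmorphM /= rmorph_nat.
by rewrite -!mulrA; congr (_ * _); rewrite mulrCA.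
Qed.

Lemma L2sqnorm_ptail (l : Qp) (f : 'rV[Qp]_m -> R[i]) : cmeas Theta f ->
  L2sqnorm mu Omega (fun x => chi R (l * x 0 ord0) * f (ptail x)) =
  ((cm gamma)%:E * L2sqnorm nu Theta f)%E.
Proof.
move=> mf; rewrite /L2sqnorm.
under eq_integral do rewrite Normc.normcM normc_chi mul1r.
rewrite (ge0_integral_cyl muT mu1 nuT nu1 a gamma (g := fun y => ((Normc.normc (f y)) ^+ 2)%:E))//.
  exact: normc2_meas.
by move=> y _; rewrite lee_fin sqr_ge0.
Qed.

Lemma cmeas_ptail (f : 'rV[Qp]_m -> R[i]) : cmeas Theta f ->
  cmeas Omega (fun x => f (ptail x)).
Proof.
have h (g : 'rV[Qp]_m -> R) : measurable_fun Theta g -> measurable_fun Omega (fun x => g (ptail x)).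
  move=> mg; rewrite -[fun x => _]/(g \o @ptail p hp m).
  apply: (measurable_comp mTheta) => //; first by move=> _ [x [_ xT] <-].
  exact: measurable_funTS (@ptail_measurable p hp m).
by move=> [m1 m2]; split; [exact: (h _ m1)|exact: (h _ m2)].
Qed.

Lemma spectrum_base (L : set 'rV[Qp]_m.+1) : nu Theta <> 0%E ->
  is_spectrum mu Omega L ->
  is_spectrum nu Theta
    [set y | exists2 t, padic_abs t <= pq ^ (- gamma) & L (pcons t y)].
Proof.
move=> T0 [_ orth dens]; split.
- by move=> y _; split; [exact: padic_char_in_L2|rewrite L2sqnorm_char].
- move=> y y' [t t1 Lt] [t' t1' Lt'] yy'.
  (* As t - t' is in the dual ball, the inner product over [Omega] is a nonzero multiple of the one
     over [Theta]. *)
  have := orth _ _ Lt Lt'; rewrite L2dot_char cintegral_cyl ptailB !pconsK.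
  rewrite !mxE !unlift_none padic_abs_sub_le// L2dot_char => h.
  have : pcons t y <> pcons t' y' by move/(congr1 (@ptail p hp m)); rewrite !pconsK.
  move/h/eqP; rewrite !mulf_eq0 (negbTE (chi_neq0 _ _)) orbF eq_complex /= eqxx andbT.
  by rewrite gt_eqF ?cm_gt0//= => /eqP.
move=> f f2 eps e0.
have [f_re f_im foo] := f2; have mf : cmeas Theta f by split.
have mF : cmeas Omega (fun x => f (ptail x)) by exact: cmeas_ptail.
have FE (g : 'rV[Qp]_m -> R[i]) : cmeas Theta g -> L2sqnorm mu Omega (fun x => g (ptail x)) =
   ((cm gamma)%:E * L2sqnorm nu Theta g)%E.
  move=> mg; rewrite -(L2sqnorm_ptail 0)//; apply: eq_L2sqnorm => x _.
  by rewrite mul0r chi0 mul1r.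
(* [cm gamma] is the factor by which squared norms grow when a function on [Theta] is lifted to
   [Omega]. *)
have [|n [i [c [Li nrmFG]]]] := dens (fun x => f (ptail x)) _ (eps * cm gamma) (mulr_gt0 e0 (cm_gt0 _)).
  by case: mF => F1 F2; split=> //; rewrite FE// lte_mul_pinfty// lee_fin ltW ?cm_gt0.
(* One scale at which all the finitely many head characters are constant on pieces. *)
have [s hs] : exists s : nat, forall k, padic_abs (i k 0 ord0) <= pq ^ (s%:Z - gamma).
  have [s hs] := padic_bound (fun k => i k 0 ord0); exists (s + `|gamma|)%N => k.
  by apply: (le_trans (hs k)); rewrite ler_expp//; lia.
pose b (j : 'I_(p ^ s)) := a + j%:R * p%:R ^ (- gamma) : Qp.
pose H j y := f y - \sum_k c k * chi R (i k 0 ord0 * b j) * ch (ptail (i k)) y.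
have mH j : cmeas Theta (H j).
  apply: cmeasB => //; apply: cmeas_sum => // k _; apply: cmeasZ => //.
  exact: padic_char_meas.
have mG : cmeas Omega (fun x => f (ptail x) - \sum_k c k * ch (i k) x).
  apply: cmeasB => //; apply: cmeas_sum => // k _; apply: cmeasZ => //.
  exact: padic_char_meas.
have N0 : 0 < ((p ^ s)%:R : R) by rewrite ltr0n expn_gt0 prime_gt0.
have nrmE : L2sqnorm mu Omega (fun x => f (ptail x) - \sum_k c k * ch (i k) x) =
    ((cm (gamma - s%:Z))%:E * \sum_(j < p ^ s) L2sqnorm nu Theta (H j))%E.
  rewrite /L2sqnorm (ge0_integral_pieces muT mu1 nuT nu1 (s := s)
    (h := fun j y => ((Normc.normc (H j y)) ^+ 2)%:E))//.
  - by move=> j; exact: normc2_meas.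
  - by move=> j y _; rewrite lee_fin sqr_ge0.
  - exact: normc2_meas.
  - move=> j x [xj _]; congr ((Normc.normc _ ^+ 2)%:E).
    congr (_ - _); apply: eq_bigr => k _.
    by rewrite padic_char_ptail (chi_piece (hs k) xj) mulrA.
(* Averaging [H j] over the pieces [j] kills the frequencies outside the dual ball. *)
pose g y := \sum_(k | padic_abs (i k 0 ord0) <= pq ^ (- gamma))
  c k * chi R (i k 0 ord0 * a) * ch (ptail (i k)) y.
have gS : in_span [set y | exists2 t, padic_abs t <= pq ^ (- gamma) & L (pcons t y)]
    (@padic_char R p hp m) g.
  apply: in_span_sum => k ik; apply: in_spanZ; apply: in_span_gen.
  by exists (i k 0 ord0) => //; rewrite pcons_ptail.
have [n' [i' [c' [Li' gE]]]] := gS.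
exists n', i', c'; split=> //.
have fgE y : f y - g y = ((p ^ s)%:R^-1 : R)%:C%C * \sum_j H j y.
  rewrite /H sumrB sumr_const card_ord.
  have -> : \sum_j \sum_k c k * chi R (i k 0 ord0 * b j) * ch (ptail (i k)) y =
      (p ^ s)%:R * g y.
    rewrite exchange_big mulr_sumr [RHS]big_mkcond /=; apply: eq_bigr => k _.
    rewrite -mulr_suml -mulr_sumr.
    have -> : \sum_j chi R (i k 0 ord0 * b j) = chi R (i k 0 ord0 * a) *
        if padic_abs (i k 0 ord0) <= pq ^ (- gamma) then (p ^ s)%:R else 0.
      rewrite -(chi_sum R (hs k)) mulr_sumr; apply: eq_bigr => j _.
      by rewrite -chiD -mulrDr.
    case: ifP => _; last by rewrite !mulr0 mul0r.
    by rewrite [c k * (_ * _%:R)]mulrA mulrAC mulrC.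
  rewrite -[f y *+ _]mulr_natl -mulrBr mulrA fmorphV rmorph_nat mulVf ?mul1r//.
  by rewrite pnatr_eq0 -lt0n expn_gt0 prime_gt0.
under eq_L2sqnorm do rewrite -gE fgE.
(* Cauchy-Schwarz gives p^s against the p^(-2s) of the squared mean. The remaining p^(-s) is
   absorbed by the relation between [cm gamma] and [cm (gamma - s)]. *)
apply: (@le_lt_trans _ _ ((p ^ s)%:R^-1%:E * \sum_(j < p ^ s) L2sqnorm nu Theta (H j))%E).
  rewrite -ge0_integral_sum//; last 2 first.
  - by move=> j; exact: normc2_meas.
  - by move=> j y _; rewrite lee_fin sqr_ge0.
  rewrite -ge0_integralZl//; last 2 first.
  - by apply: emeasurable_sum => j; exact: normc2_meas.
  - by move=> y _; apply: sume_ge0 => j _; rewrite lee_fin sqr_ge0.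
  apply: ge0_le_integral => //.
  - by move=> y _; rewrite lee_fin sqr_ge0.
  - by apply: normc2_meas => //; apply: cmeasZ; apply: cmeas_sum.
  - by apply: measurable_funeM; apply: emeasurable_sum => j; exact: normc2_meas.
  - move=> y _; rewrite sumEFin -EFinM lee_fin Normc.normcM exprMn.
    have -> : Normc.normc ((p ^ s)%:R^-1 : R)%:C%C = (p ^ s)%:R^-1.
      by rewrite /= expr0n addr0 sqrtr_sqr ger0_norm// invr_ge0 ltW.
    rewrite expr2 -mulrA ler_pM2l ?invr_gt0// -ler_pdivlMl ?invr_gt0// invrK.
    exact: normc2_sum_le.
rewrite lte_pdivrMl// -(@lte_pmul2l _ (cm (gamma - s%:Z))%:E) ?lte_fin ?cm_gt0// -nrmE.
apply: lt_le_trans nrmFG _; rewrite -!EFinM lee_fin (cmass_split muT mu1 gamma s).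
by rewrite mulrC -mulrA mulrCA.
Qed.

(** Choice is applied to the class of t modulo the dual ball as a set, so congruent points get the
    same representative by extensionality. The class contains t, so the default 0 is never a
    fallback. *)
Definition coset_rep (t : Qp) : Qp := xget 0 [set u | padic_abs (u - t) <= pq ^ (- gamma)].

Lemma coset_repP t : padic_abs (coset_rep t - t) <= pq ^ (- gamma).
Proof.
have : exists u, padic_abs (u - t) <= pq ^ (- gamma).
  by exists t; rewrite subrr padic_abs0 ltW ?expp_gt0.
exact: (@xgetPex _ 0 [set u | padic_abs (u - t) <= pq ^ (- gamma)]).
Qed.

Lemma eq_coset_rep t t' : padic_abs (t - t') <= pq ^ (- gamma) -> coset_rep t = coset_rep t'.
Proof.
move=> tt'; congr (xget 0 _); apply/seteqP; split=> u /= h.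
  exact: padic_abs_trans h tt'.
by apply: (padic_abs_trans h); rewrite padic_abs_sub.
Qed.

Lemma coset_rep_id t : coset_rep (coset_rep t) = coset_rep t.
Proof. exact/eq_coset_rep/coset_repP. Qed.

(** The fixed points of [coset_rep] are its values, one in each class. *)
Definition cyl_spectrum (L : set 'rV[Qp]_m) : set 'rV[Qp]_m.+1 :=
  [set v : 'rV[Qp]_m.+1 | coset_rep (v 0 ord0) = v 0 ord0 /\ L (ptail v)].

(** * Orthogonality and totality of the product spectrum *)

Section Product.
Variable L : set 'rV[Qp]_m.
Hypothesis L_spec : is_spectrum nu Theta L.
Local Notation V := (in_closed_span mu Omega (cyl_spectrum L) (@padic_char R p hp m.+1)).

Let me i : cyl_spectrum L i -> cmeas Omega (@padic_char R p hp m.+1 i).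
Proof. by move=> _; exact: padic_char_meas. Qed.

Let me' i : L i -> cmeas Theta (@padic_char R p hp m i).
Proof. by move=> _; exact: padic_char_meas. Qed.

Lemma chi_head_meas l : cmeas Omega (fun x : 'rV[Qp]_m.+1 => chi R (l * x 0 ord0)).
Proof.
have -> : (fun x : 'rV[Qp]_m.+1 => chi R (l * x 0 ord0)) = ch (pcons l 0).
  apply/funext => x; rewrite padic_char_ptail pcons0 pconsK padic_charE.
  by rewrite /padic_dot big1 ?chi0 ?mulr1// => j _; rewrite mxE mul0r.
exact: padic_char_meas.
Qed.

(** An arbitrary head frequency l may replace its representative: (l - [coset_rep l]) (x - a) is in
    Z_p for x in the ball, so the two characters differ by the phase chi((l - [coset_rep l]) a). *)
Lemma closed_span_char l y : L y -> V (fun x : 'rV[Qp]_m.+1 => chi R (l * x 0 ord0) * ch y (ptail x)).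
Proof.
move=> Ly; apply: (@eq_closed_span _ _ _ mu Omega _ _ _
  (fun x : 'rV[Qp]_m.+1 => chi R ((l - coset_rep l) * a) * ch (pcons (coset_rep l) y) x)).
  move=> x [xa _]; rewrite padic_char_ptail pcons0 pconsK mulrA -chiD; congr (_ * _).
  apply: chi_congr.
  have -> : (l - coset_rep l) * a + coset_rep l * x 0 ord0 - l * x 0 ord0 =
      (coset_rep l - l) * (x 0 ord0 - a) by ring.
  rewrite padic_absM.
  apply: (@le_trans _ _ (pq ^ (- gamma) * pq ^ gamma)).
    by apply: ler_pM; rewrite ?padic_abs_ge0 ?coset_repP.
  by rewrite -expfzDr ?p_neq0// addNr expr0z.
apply: (closed_spanZ Omega_measurable me); first exact: padic_char_meas.
apply: in_span_closed_span => //; apply: in_span_gen; split; last by rewrite pconsK.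
by rewrite pcons0 coset_rep_id.
Qed.

Lemma closed_span_tensor l f : in_L2 nu Theta f -> V (fun x : 'rV[Qp]_m.+1 => chi R (l * x 0 ord0) * f (ptail x)).
Proof.
move=> f2; have [f_re f_im foo] := f2; have mf : cmeas Theta f by split.
have mlf g : cmeas Theta g -> cmeas Omega (fun x : 'rV[Qp]_m.+1 => chi R (l * x 0 ord0) * g (ptail x)).
  by move=> mg; apply: cmeasM; [exact: chi_head_meas|exact: cmeas_ptail].
have [_ _ dens] := L_spec.
apply: (closed_span_lim Omega_measurable me); first exact: mlf.
(* Multiplying by a head character of modulus 1 and lifting to [Omega] scales squared distances by
   [cm gamma]. *)
move=> eps e0; have [n [i [c [Li fg]]]] := dens f f2 _ (divr_gt0 e0 (cm_gt0 gamma)).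
pose g y := \sum_k c k * ch (i k) y.
have mg : cmeas Theta g.
  by apply: cmeas_sum => k _; apply: cmeasZ => //; exact: me'.
exists (fun x : 'rV[Qp]_m.+1 => chi R (l * x 0 ord0) * g (ptail x)); split; first exact: mlf.
  apply: (@eq_closed_span _ _ _ mu Omega _ _ _
    (fun x : 'rV[Qp]_m.+1 => \sum_k c k * (chi R (l * x 0 ord0) * ch (i k) (ptail x)))).
    by move=> x _; rewrite mulr_sumr; apply: eq_bigr => k _; rewrite mulrCA.
  have mk k : cmeas Omega (fun x : 'rV[Qp]_m.+1 => chi R (l * x 0 ord0) * ch (i k) (ptail x)).
    by apply: mlf; exact: me'.
  apply: (closed_span_sum Omega_measurable me) => k _; first exact: cmeasZ.
  by apply: (closed_spanZ Omega_measurable me) => //; exact: closed_span_char.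
rewrite (_ : L2sqnorm _ _ _ = ((cm gamma)%:E * L2sqnorm nu Theta (fun y => f y - g y)%R)%E); last first.
  rewrite -(L2sqnorm_ptail l); last exact: cmeasB.
  by apply: eq_L2sqnorm => x _; rewrite mulrBr.
have := fg; rewrite -(@lte_pmul2l _ (cm gamma)%:E) ?lte_fin ?cm_gt0//.
by move/lt_le_trans; apply; rewrite -EFinM lee_fin mulrC divfK// gt_eqF ?cm_gt0.
Qed.

Lemma cindic_in_L2 (B : set 'rV[Qp]_m) : measurable B -> in_L2 nu Theta (cindic R B).
Proof.
move=> mB; have [h1 h2] := cindic_meas R Theta mB; split=> //.
rewrite L2sqnorm_indic//; apply: le_lt_trans Tfin.
by apply: le_measure; rewrite ?inE//; exact: measurableI.
Qed.

Lemma closed_span_setT : V (cindic R setT).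
Proof.
apply: (@eq_closed_span _ _ _ mu Omega _ _ _
  (fun x : 'rV[Qp]_m.+1 => chi R (0 * x 0 ord0) * cindic R setT (ptail x))); last exact/closed_span_tensor/cindic_in_L2.
by move=> x _; rewrite mul0r chi0 mul1r /cindic !indicT.
Qed.

Lemma closed_span_set0 (f : 'rV[Qp]_m.+1 -> R[i]) : (forall x, Omega x -> f x = 0) -> V f.
Proof.
move=> f0; apply: (@eq_closed_span _ _ _ mu Omega _ _ _ (fun=> 0)); first by move=> x /f0.
by apply: in_span_closed_span; exact: in_span0.
Qed.

Lemma closed_span_pbox (c : 'rV[Qp]_m.+1) (k : int) : k <= gamma -> V (cindic R (pbox c k)).
Proof.
move=> kg.
have pboxE x : pbox c k x <-> padic_abs (x 0 ord0 - c 0 ord0) <= pq ^ k /\ pbox (ptail c) k (ptail x).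
  split=> [h|[h0 h] j]; first by split=> [|j]; [exact: h|rewrite !ptailE].
  by case: (unliftP ord0 j) => [i ->|->//]; have := h i; rewrite !ptailE.
(* As k <= gamma, a box whose head centre lies outside B_gamma(a) misses [Omega]. *)
have [ca|/negP ca] := boolP (padic_abs (c 0 ord0 - a) <= pq ^ gamma); last first.
  apply: closed_span_set0 => x [xa _]; rewrite /cindic indicE memNset// => /pboxE[xc _].
  apply: ca; apply: (padic_abs_trans _ xa); rewrite padic_abs_sub.
  by apply: (le_trans xc); rewrite ler_expp.
pose s := `|gamma - k|%N.
have sE : s%:Z = gamma - k by rewrite /s gez0_abs// subr_ge0.
have N0 : ((p ^ s)%:R : R[i]) != 0 by rewrite pnatr_eq0 -lt0n expn_gt0 prime_gt0.
(* On [B_gamma(a)] the indicator of [B_k(c 0)] is an average of [p^s] characters. *)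
have mB := pbox_measurable (ptail c) k.
apply: (@eq_closed_span _ _ _ mu Omega _ _ _ (fun x : 'rV[Qp]_m.+1 => \sum_(j < p ^ s)
   (chi R (- (j%:R * p%:R ^ k * c 0 ord0)) / (p ^ s)%:R) *
   (chi R (j%:R * p%:R ^ k * x 0 ord0) * cindic R (pbox (ptail c) k) (ptail x)))).
  move=> x [xa _].
  (* Here [chi_sum] is applied with exponent -k and the roles exchanged: x - c is fixed, the
     frequencies j p^k run, and the threshold p^k is the radius of the box. *)
  have xc : padic_abs (x 0 ord0 - c 0 ord0) <= pq ^ (s%:Z - (- k)).
    by rewrite sE opprK subrK; apply: (padic_abs_trans xa); rewrite padic_abs_sub.
  have := chi_sum R xc; rewrite opprK => S.
  set J := cindic R (pbox (ptail c) k) (ptail x).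
  have termE (j : 'I_(p ^ s)) : chi R (- (j%:R * p%:R ^ k * c 0 ord0)) / (p ^ s)%:R *
      (chi R (j%:R * p%:R ^ k * x 0 ord0) * J) =
      J / (p ^ s)%:R * chi R ((x 0 ord0 - c 0 ord0) * (j%:R * p%:R ^ k)).
    have -> : (x 0 ord0 - c 0 ord0) * (j%:R * p%:R ^ k) =
        - (j%:R * p%:R ^ k * c 0 ord0) + j%:R * p%:R ^ k * x 0 ord0 by ring.
    rewrite chiD; move: (_^-1) (chi _ _) (chi _ _) => u v w; ring.
  under eq_bigr do rewrite termE.
  rewrite -mulr_sumr S; case: ifPn => [xk|/negP xk]; last first.
    by rewrite mulr0 /cindic indicE memNset// => /pboxE[].
  rewrite divfK// /J /cindic !indicE; congr ((nat_of_bool _)%:R%:C)%C.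
  by apply/idP/idP; rewrite !inE => h; apply/pboxE || case/pboxE: h.
have mj j : cmeas Omega (fun x : 'rV[Qp]_m.+1 => chi R (j%:R * p%:R ^ k * x 0 ord0) * cindic R (pbox (ptail c) k) (ptail x)).
  apply: cmeasM; first exact: chi_head_meas.
  by apply: cmeas_ptail; exact: cindic_meas.
apply: (closed_span_sum Omega_measurable me) => j _; first exact: cmeasZ.
by apply: (closed_spanZ Omega_measurable me) => //; apply: closed_span_tensor; exact: cindic_in_L2.
Qed.

Lemma spectrum_cyl : nu Theta <> 0%E -> is_spectrum mu Omega (cyl_spectrum L).
Proof.
move=> T0; have [_ orth _] := L_spec.
have muO := mu_cyl muT mu1 nuT nu1 a gamma mTheta.
split.
- move=> v _; split; first by apply: padic_char_in_L2; [exact: Omega_measurable|exact: Omega_fin].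
  rewrite L2sqnorm_char ?muO; last exact: Omega_measurable.
  move=> /eqP.
  by rewrite mule_eq0 eqe gt_eqF ?cm_gt0//= => /eqP.
- move=> v v' [v0 Lv] [v0' Lv'] vv'.
  (* If the heads differ by more than the dual ball the integral is zero. Otherwise both are the
     same representative, so the tails must differ. *)
  rewrite L2dot_char cintegral_cyl; case: ifPn => // /[!mxE] hv.
  have tv : ptail v <> ptail v'.
    move=> tv; apply: vv'; rewrite -(pcons_ptail v) -(pcons_ptail v') tv -v0 -v0'.
    by rewrite (eq_coset_rep hv).
  have := orth _ _ Lv Lv' tv; rewrite L2dot_char ptailB => ->.
  by rewrite mulr0.
move=> f f2 eps e0.
have aB B : measurable B -> V (cindic R B).
  (* With [n0] equal to |gamma|, every generating box has radius at most p^gamma, as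
     [closed_span_pbox] requires. *)
  apply: (closed_span_indic Omega_measurable me Omega_fin (@pboxes_setI p hp m.+1 `|gamma|%N)).
  - exact: pboxes_measurable.
  - exact: closed_span_setT.
  move=> _ [->|[c [n ->]]]; last by apply: closed_span_pbox; lia.
  by apply: closed_span_set0 => x _; rewrite /cindic indic0.
have [g [n [i [c [Li gE]]]] fg] := closed_span_in_L2 Omega_measurable me aB f2 e0.
exists n, i, c; split=> //.
by under eq_L2sqnorm do rewrite -gE.
Qed.

End Product.

End Cylinder.

Theorem theorem1p3 (R : realType) (p : nat) (hp : prime p)
    (d : nat) (hd : (2 <= d)%N)
    (mu : {measure set 'rV[padic hp]_d -> \bar R})
    (nu : {measure set 'rV[padic hp]_d.-1 -> \bar R})
    (hmu : is_padic_haar mu) (hnu : is_padic_haar nu)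
    (a : padic hp) (gamma : int) (Theta : set 'rV[padic hp]_d.-1)
    (Omega : set 'rV[padic hp]_d)
    (hTheta : measurable Theta)
    (hOmega : Omega = padic_cylinder (ltnW hd) (padic_ball a gamma) Theta)
    (mOmega : measurable Omega) (hpos : (0 < mu Omega < +oo)%E) :
  is_spectral_set mu Omega <-> is_spectral_set nu Theta.
Proof.
case: d hd mu nu hmu hnu Theta Omega hTheta hOmega mOmega hpos => // m hd mu nu.
move=> [muT mu1] [nuT nu1] Theta Omega mTheta OmegaE mOmega hpos.
have boxE n : pbox 0 0 = [set x : 'rV[padic hp]_n | forall j, padic_abs (x 0 j) <= 1].
  by apply/seteqP; split=> x h j; have := h j; rewrite mxE subr0 expr0z.
rewrite -boxE in mu1; rewrite -boxE in nu1.
have {OmegaE} OmegaE : Omega = cyl a gamma Theta.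
  rewrite OmegaE /padic_cylinder.
  by have -> : Ordinal (ltnW hd) = ord0 by exact: val_inj.
have muO := mu_cyl muT mu1 nuT nu1 a gamma mTheta; rewrite -OmegaE in muO.
have c0 := cmass_gt0 muT mu1 gamma.
(* The ball has positive finite mass, so a null or infinite [Theta] would make [Omega] null or
   infinite. *)
have [nu0 nuoo] : (0 < nu Theta /\ nu Theta < +oo)%E.
  move: hpos; rewrite muO; split.
    rewrite lt0e measure_ge0 andbT; apply: contraTneq hpos => ->.
    by rewrite mule0 ltxx.
  rewrite ltey; apply: contraTneq hpos => ->.
  by rewrite gt0_muley ?lte_fin// ltxx andbF.
have T0 : nu Theta <> 0%E by move=> T0; rewrite T0 ltxx in nu0.
split=> -[_ _ [L]].
  rewrite OmegaE => /(spectrum_base muT mu1 nuT nu1 mTheta nuoo T0) L'.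
  by split=> //; [rewrite nu0|eexists; exact: L'].
move=> LT; split=> //; exists (cyl_spectrum gamma L).
by rewrite OmegaE; exact: (spectrum_cyl muT mu1 nuT nu1 a gamma mTheta nuoo LT T0).
Qed.
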